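(* For every fixed constant number of machines $m$, the problem $Qm||C_{\max}$ can be solved in $\widetilde{O}(p_{\max}^{2m+2} + n)$ time, where $n$ is the number of jobs and $p_{\max}=\max_{j\in[n]} p_j$.
   Context: Problem $Qm||C_{\max}$ (makespan minimization on $m$ related parallel machines): given $n$ jobs $J=[n]=\{1,\dots,n\}$ with processing requirements $p_j\in\mathbb{N}$ and $m$ machines $M_1,\dots,M_m$ with positive speeds $q_i$, the processing time of job $j$ on $M_i$ is $p_{i,j}=p_j/q_i$. A schedule is a map $\sigma:[n]\to[m]$; the load of $M_i$ is $M_i(\sigma)=\sum_{j\in\sigma^{-1}(i)}p_{i,j}$, and the makespan is $C_{\max}(\sigma)=\max_{i\in[m]}M_i(\sigma)$. The goal is to compute a schedule of minimum makespan. The number $m$ of machines is a fixed constant independent of $n$. The notation $\widetilde{O}(\cdot)$ suppresses polylogarithmic factors. *)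

(* Defs.v *)
From mathcomp Require Import all_boot all_order all_algebra.

Set Implicit Arguments.
Unset Strict Implicit.
Unset Printing Implicit Defensive.

Import Order.TTheory GRing.Theory Num.Theory.

(** * The problem [Qm||Cmax] *)

(* Speeds are positive rationals, so that an instance is a finite object that
   can be handed to a machine.  Processing requirements may be 0.  The number
   [m] of machines is a parameter of the type of instances, not a component of
   an instance. *)
Record instance (m : nat) : Type := Instance {
  njobs : nat;
  njobs_gt0 : 0 < njobs;
  preq : 'I_njobs -> nat;
  speed : 'I_m -> rat;
  speed_gt0 : forall i : 'I_m, (0 < speed i)%R
}.

Definition pmax (m : nat) (I : instance m) : nat :=
  \max_(j < njobs I) preq j.

Definition schedule (m : nat) (I : instance m) : Type := 'I_(njobs I) -> 'I_m.

Definition load (m : nat) (I : instance m) (s : schedule I) (i : 'I_m) : rat :=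
  (\sum_(j < njobs I | s j == i) (preq j)%:R / speed I i)%R.

(* Loads are nonnegative, so 0 is a neutral base value for the maximum. *)
Definition makespan (m : nat) (I : instance m) (s : schedule I) : rat :=
  (\big[Num.max/0]_(i < m) load s i)%R.

Definition optimal (m : nat) (I : instance m) (s : schedule I) : Prop :=
  forall s' : schedule I, (makespan s <= makespan s')%R.

(** * The word RAM

    Programs are structured programs over three-address instructions.  They
    act on registers and on a random access memory, both holding natural
    numbers.  Every instruction and every test costs one unit of time. *)

Inductive binop : Type := Add | Sub | Mul | Div | Mod | Lt | Eq.

(* [Sub] is truncated and [Div], [Mod] follow the conventions of [%/], [%%]
   when the divisor is 0. *)
Definition eval_binop (o : binop) (a b : nat) : nat :=
  match o with
  | Add => a + b
  | Sub => a - b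
  | Mul => a * b
  | Div => a %/ b
  | Mod => a %% b
  | Lt => nat_of_bool (a < b)
  | Eq => nat_of_bool (a == b)
  end.

Inductive cmd : Type :=
  | Skip
  | Const of nat & nat              (* r_x := k *)
  | Op of binop & nat & nat & nat   (* r_x := r_y o r_z *)
  | Read of nat & nat               (* r_x := mem[r_y] *)
  | Write of nat & nat              (* mem[r_x] := r_y *)
  | Seq of cmd & cmd
  | If of nat & cmd & cmd           (* test r_x != 0 *)
  | While of nat & cmd.             (* test r_x != 0 *)

Record state : Type := State { regs : nat -> nat; mem : nat -> nat }.

Definition upd (f : nat -> nat) (x v : nat) : nat -> nat :=
  fun y => if y == x then v else f y.

Definition set_reg (st : state) (x v : nat) : state :=
  State (upd (regs st) x v) (mem st).

Definition set_mem (st : state) (a v : nat) : state :=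
  State (regs st) (upd (mem st) a v).

(* [exec w c st t st'] : with words of [w] bits, [c] started in [st] terminates
   in [st'] after exactly [t] time units.  There is no rule for an instruction
   whose result does not fit into a word, so a derivation also certifies that
   no overflow occurs. *)
Inductive exec (w : nat) : cmd -> state -> nat -> state -> Prop :=
  | ExecSkip st :
      exec w Skip st 1 st
  | ExecConst st x k :
      k < 2 ^ w ->
      exec w (Const x k) st 1 (set_reg st x k)
  | ExecOp st o x y z :
      eval_binop o (regs st y) (regs st z) < 2 ^ w ->
      exec w (Op o x y z) st 1
        (set_reg st x (eval_binop o (regs st y) (regs st z)))
  | ExecRead st x y :
      mem st (regs st y) < 2 ^ w ->
      exec w (Read x y) st 1 (set_reg st x (mem st (regs st y)))
  | ExecWrite st x y :
      exec w (Write x y) st 1 (set_mem st (regs st x) (regs st y))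
  | ExecSeq st1 st2 st3 c1 c2 t1 t2 :
      exec w c1 st1 t1 st2 -> exec w c2 st2 t2 st3 ->
      exec w (Seq c1 c2) st1 (t1 + t2) st3
  | ExecIfTrue st st' x c1 c2 t :
      regs st x != 0 -> exec w c1 st t st' ->
      exec w (If x c1 c2) st t.+1 st'
  | ExecIfFalse st st' x c1 c2 t :
      regs st x = 0 -> exec w c2 st t st' ->
      exec w (If x c1 c2) st t.+1 st'
  | ExecWhileTrue st1 st2 st3 x c t1 t2 :
      regs st1 x != 0 -> exec w c st1 t1 st2 -> exec w (While x c) st2 t2 st3 ->
      exec w (While x c) st1 (t1 + t2).+1 st3
  | ExecWhileFalse st x c :
      regs st x = 0 ->
      exec w (While x c) st 1 st.

(** * Solving [Qm||Cmax] on the word RAM *)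

(* n, p_1, ..., p_n, followed by the numerators and denominators of
   q_1, ..., q_m. *)
Definition encode (m : nat) (I : instance m) : seq nat :=
  njobs I ::
    [seq preq j | j <- enum 'I_(njobs I)] ++
    flatten [seq [:: absz (numq (speed I i)); absz (denq (speed I i))]
            | i <- enum 'I_m].

Definition init_state (m : nat) (I : instance m) : state :=
  State (fun=> 0) (nth 0 (encode I)).

(* Number of bits of the largest number in the input (which contains n). *)
Definition input_bits (m : nat) (I : instance m) : nat :=
  (trunc_log 2 (\max_(x <- encode I) x)).+1.

(* The single program [c] finds an optimal schedule of every instance [I] in
   time at most [T I], on words of length [b * input_bits I] for a constant
   [b].  The machine of job [j] replaces the processing requirement of [j] in
   memory. *)
Definition solves_in_time (m : nat) (c : cmd) (T : instance m -> nat) : Prop :=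
  exists b : nat, forall I : instance m,
    exists (t : nat) (st : state) (s : schedule I),
      [/\ exec (b * input_bits I) c (init_state I) t st,
          t <= T I,
          forall j : 'I_(njobs I), mem st j.+1 = s j
        & optimal s].

(* T = O~(f), that is, T = O(f log^k f) for some constant k. *)
Definition softO (X : Type) (T f : X -> nat) : Prop :=
  exists C k : nat, forall x : X, T x <= C * f x * (trunc_log 2 (f x)).+1 ^ k.

(* Main.v *)
From Pilot Require Import Defs.
From mathcomp Require Import all_boot all_order all_algebra.
From mathcomp Require Import zify.
(* Imported again so that [mem] is the memory of a state, not the one of ssrbool. *)
Import Pilot.Defs.

(** Let p be the largest size.  The n_t jobs of size t are split by levels: at
    level l at most m jobs of size t are set aside, and the others are halved, so
    n_t is a sum of 2^l s_{l,t} with s_{l,t} <= m; every distribution of the n_t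
    jobs over the machines splits in the same way.  A load vector is built from the
    highest level down, by doubling it and adding one job at a time.

    In an optimal schedule one may assume that every load is within m p of the share
    of its machine in the total work, a share proportional to its speed: otherwise a
    greedy schedule is at least as good.  All partial load vectors at level l are then
    within O(m p^2) of the shares divided by 2^l, so that O(p^2)^m states are enough
    for each of the O(m p log n) slots: O~(p^(2m+1)) steps in all.  Backtracking
    gives the number of jobs of each size on each machine.

    The program is written in a small language of expressions and loops.  Its
    overflow checks reduce to one bound on all variables and memory cells, because the
    width of an expression is then bounded syntactically. *)

Set Implicit Arguments.
Unset Strict Implicit.
Unset Printing Implicit Defensive.

(** * Expressions and loops on the word RAM *)

(** The split must be fixed before the distribution over the machines is known, so the number of
    jobs set aside may depend on the count alone. This is where [m] comes from: halving the count on
    each machine leaves at most one odd job per machine, so any distribution of [c] jobs contains at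
    least [(c - m) / 2] pairs, and exactly that number, rounded up, can be kept. Adding [m - 1]
    turns this map into plain halving rounded down, which gives the closed form of [left].

    The size of the windows comes from a geometric sum. A level has O(m p) slots, each adding at
    most [p] in units of that level. The slots of all lower levels together weigh no more than a
    constant number of such levels, so the load still to come is O(m p^2) units of the current
    level. The deviation [m p] from the shares is of lower order.

    Speeds are rational, but all comparisons are made between integers: loads are weighted by
    numbers inversely proportional to the speeds, which rescales every completion time by the same
    factor. *)

Inductive expr : Type :=
  | Num of nat
  | Var of nat
  | Bin of binop & expr & expr
  | Fetch of expr.

Inductive stmt : Type :=
  | SAssign of nat & expr
  | SStore of expr & expr
  | SSeq of stmt & stmt
  | SIf of expr & stmt
  | SWhile of expr & stmt.

Fixpoint eval (h : state) (e : expr) : nat :=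
  match e with
  | Num k => k
  | Var x => regs h x
  | Bin o a b => eval_binop o (eval h a) (eval h b)
  | Fetch a => mem h (eval h a)
  end.

(* Disjoint for all arguments, so variable names need no bound. *)
Definition var (x : nat) : nat := x.*2.
Definition tmp (d : nat) : nat := d.*2.+1.

(** The temporaries form a stack: those below depth [d] hold pending operands and are left alone. A
    register is copied by adding 0, since the machine has no move instruction. *)
Fixpoint cexpr (d : nat) (e : expr) : cmd :=
  match e with
  | Num k => Const (tmp d) k
  | Var x => Seq (Const (tmp d) 0) (Op Add (tmp d) (var x) (tmp d))
  | Bin o a b =>
      Seq (cexpr d a) (Seq (cexpr d.+1 b) (Op o (tmp d) (tmp d) (tmp d.+1)))
  | Fetch a => Seq (cexpr d a) (Read (tmp d) (tmp d))
  end.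

Fixpoint ecost (e : expr) : nat :=
  match e with
  | Num _ => 1
  | Var _ => 2
  | Bin _ a b => ecost a + (ecost b + 1)
  | Fetch a => ecost a + 1
  end.

Fixpoint compile (c : stmt) : cmd :=
  match c with
  | SAssign x e =>
      Seq (cexpr 0 e) (Seq (Const (tmp 1) 0) (Op Add (var x) (tmp 0) (tmp 1)))
  | SStore a e => Seq (cexpr 0 a) (Seq (cexpr 1 e) (Write (tmp 0) (tmp 1)))
  | SSeq a b => Seq (compile a) (compile b)
  | SIf e a => Seq (cexpr 0 e) (If (tmp 0) (compile a) Skip)
  | SWhile e a =>
      Seq (cexpr 0 e) (While (tmp 0) (Seq (compile a) (cexpr 0 e)))
  end.

(* Junk value 0 on loops: only used for loop-free statements. *)
Fixpoint scost (c : stmt) : nat :=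
  match c with
  | SAssign x e => ecost e + 2
  | SStore a e => ecost a + (ecost e + 1)
  | SSeq a b => scost a + scost b
  | SIf e a => ecost e + (scost a).+2
  | SWhile _ _ => 0
  end.

Definition wcost (N : nat) (e : expr) (c : stmt) : nat :=
  ecost e + (N * (scost c + ecost e).+1).+1.

(** * Word widths, and correctness of the compilation with time bounds *)

Section Width.

(* Every variable and memory cell is kept below [2 ^ (K * beta)]; the value of
   an expression [e] is then below [2 ^ (ewidth e * beta)]. *)
Variable K : nat.

Fixpoint ewidth (e : expr) : nat :=
  match e with
  | Num k => k.+1
  | Var x => K
  | Bin o a b => (ewidth a + ewidth b).+1
  | Fetch a => ewidth a + K
  end.

Fixpoint swidth (c : stmt) : nat :=
  match c with
  | SAssign x e => (ewidth e + K).+1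
  | SStore a e => ewidth a + ewidth e
  | SSeq a b => swidth a + swidth b
  | SIf e a => ewidth e + swidth a
  | SWhile e a => ewidth e + swidth a
  end.

Variables (beta w : nat).
Hypothesis beta_gt0 : 0 < beta.

Definition fits (h : state) : Prop :=
  (forall x, regs h x < 2 ^ (K * beta)) /\ (forall a, mem h a < 2 ^ (K * beta)).

Definition agree (st h : state) : Prop :=
  mem st = mem h /\ forall x, regs st (var x) = regs h x.

(** A product needs the sum of the two widths; the extra [beta] bits give the factor 2 that absorbs
    the carry of a sum. *)
Lemma eval_binop_lt (o : binop) (x y a b : nat) :
  x < 2 ^ (a * beta) -> y < 2 ^ (b * beta) ->
  eval_binop o x y < 2 ^ ((a + b).+1 * beta).
Proof.
move=> xa yb.
have pa : 0 < 2 ^ (a * beta) by rewrite expn_gt0.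
have pb : 0 < 2 ^ (b * beta) by rewrite expn_gt0.
have pc : 2 <= 2 ^ beta by rewrite -{1}(expn1 2) leq_pexp2l.
set A := 2 ^ (a * beta) in xa pa; set B := 2 ^ (b * beta) in yb pb.
have ->: 2 ^ ((a + b).+1 * beta) = 2 ^ beta * (A * B).
  by rewrite mulSn mulnDl !expnD.
have le2 : 2 * (A * B) <= 2 ^ beta * (A * B) by rewrite leq_mul2r pc orbT.
have xN : x < A * B by rewrite (leq_trans xa) ?leq_pmulr.
have yN : y < A * B by rewrite (leq_trans yb) ?leq_pmull.
have xy : x * y < A * B by rewrite ltn_mul.
by have dx := leq_div x y; have mx := leq_mod x y; case: o => /=; lia.
Qed.

Lemma eval_lt (h : state) (e : expr) :
  fits h -> eval h e < 2 ^ (ewidth e * beta).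
Proof.
move=> [hr hm]; elim: e => [k|x|o a iha b ihb|a iha] /=.
- apply: leq_trans (ltn_expl _ (isT : 1 < 2)) _.
  by rewrite leq_exp2l // (leq_trans (leqnSn k)) // leq_pmulr.
- exact: hr.
- exact: eval_binop_lt.
- by apply: leq_trans (hm _) _; rewrite leq_exp2l // leq_mul2r leq_addl orbT.
Qed.


Lemma upd_eq (f : nat -> nat) (x v : nat) : upd f x v x = v.
Proof. by rewrite /upd eqxx. Qed.

Lemma upd_neq (f : nat -> nat) (x v y : nat) : y != x -> upd f x v y = f y.
Proof. by rewrite /upd => /negbTE ->. Qed.

Lemma agree_tmp (st h : state) (d v : nat) :
  agree st h -> agree (set_reg st (tmp d) v) h.
Proof.
by case=> am ar; split=> //= x; rewrite upd_neq ?ar // /tmp /var; lia.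
Qed.

Lemma exec_cexpr (h : state) (e : expr) (d : nat) (st : state) :
  fits h -> agree st h -> ewidth e * beta <= w ->
  exists st', [/\ exec w (cexpr d e) st (ecost e) st', agree st' h,
    forall d', d' < d -> regs st' (tmp d') = regs st (tmp d')
    & regs st' (tmp d) = eval h e].
Proof.
move=> hf.
have val_lt e1 : ewidth e1 * beta <= w -> eval h e1 < 2 ^ w.
  by move=> ew; apply: leq_trans (eval_lt _ hf) _; rewrite leq_exp2l.
have tmp_lt st1 d1 v d' : d' < d1 ->
    regs (set_reg st1 (tmp d1) v) (tmp d') = regs st1 (tmp d').
  by move=> lt_d; rewrite /= upd_neq // /tmp; lia.
elim: e d st => [k|x|o a iha b ihb|a iha] d st ag ew /=.
- have := val_lt _ ew => /= kw.
  exists (set_reg st (tmp d) k); split; first exact: ExecConst.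
  + exact: agree_tmp.
  + by move=> d' /tmp_lt ->.
  + by rewrite /= upd_eq.
- have := val_lt _ ew => /= xw.
  set st1 := set_reg st (tmp d) 0.
  have ag1 : agree st1 h by exact: agree_tmp.
  have ev : eval_binop Add (regs st1 (var x)) (regs st1 (tmp d)) = regs h x.
    by rewrite /eval_binop ag1.2 /= upd_eq addn0.
  exists (set_reg st1 (tmp d) (regs h x)); split.
  + rewrite -[2]/(1 + 1); apply: (@ExecSeq _ st st1).
      by apply: ExecConst; rewrite expn_gt0.
    by rewrite -ev; apply: ExecOp; rewrite ev.
  + exact: agree_tmp.
  + by move=> d' lt_d; rewrite !tmp_lt.
  + by rewrite /= upd_eq.
- have aw : ewidth a * beta <= w.
    by apply: leq_trans ew; rewrite leq_mul2r; apply/orP; right=> /=; lia.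
  have bw : ewidth b * beta <= w.
    by apply: leq_trans ew; rewrite leq_mul2r; apply/orP; right=> /=; lia.
  have [st1 [ex1 ag1 low1 val1]] := iha d st ag aw.
  have [st2 [ex2 ag2 low2 val2]] := ihb d.+1 st1 ag1 bw.
  have ev : eval_binop o (regs st2 (tmp d)) (regs st2 (tmp d.+1)) =
            eval_binop o (eval h a) (eval h b).
    by rewrite val2 low2 // val1.
  exists (set_reg st2 (tmp d) (eval_binop o (eval h a) (eval h b))); split.
  + apply: ExecSeq ex1 _; apply: ExecSeq ex2 _.
    by rewrite -ev; apply: ExecOp; rewrite ev; exact: val_lt ew.
  + exact: agree_tmp.
  + by move=> d' lt_d; rewrite tmp_lt // low2 ?low1 // ltnW.
  + by rewrite /= upd_eq.
- have aw : ewidth a * beta <= w.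
    by apply: leq_trans ew; rewrite leq_mul2r /= leq_addr orbT.
  have [st1 [ex1 ag1 low1 val1]] := iha d st ag aw.
  have ev : mem st1 (regs st1 (tmp d)) = mem h (eval h a).
    by rewrite ag1.1 val1.
  exists (set_reg st1 (tmp d) (mem h (eval h a))); split.
  + apply: ExecSeq ex1 _.
    by rewrite -ev; apply: ExecRead; rewrite ev; exact: val_lt ew.
  + exact: agree_tmp.
  + by move=> d' lt_d; rewrite tmp_lt ?low1.
  + by rewrite /= upd_eq.
Qed.


(** Total correctness with a time bound, on states that ignore the temporaries. The syntactic width
    controls all intermediate results, so the rules for assignment and store only ask that the value
    kept is below [2 ^ (K * beta)]. *)
Definition wp (c : stmt) (h : state) (T : nat) (Q : state -> Prop) : Prop :=
  swidth c * beta <= w -> fits h -> forall st, agree st h ->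
  exists t st' h',
    [/\ exec w (compile c) st t st', t <= T, agree st' h', fits h' & Q h'].

Lemma wp_conseq (c : stmt) (h : state) (T T' : nat) (Q Q' : state -> Prop) :
  wp c h T Q -> T <= T' -> (forall h', Q h' -> Q' h') -> wp c h T' Q'.
Proof.
move=> wpc TT' QQ' cw hf st ag.
have [t [st' [h' [ex tT ag' hf' q]]]] := wpc cw hf st ag.
exists t, st', h'; split=> //; [exact: leq_trans tT TT' | exact: QQ'].
Qed.

Lemma wp_seq (c1 c2 : stmt) (h : state) (T1 T2 : nat) (Q : state -> Prop) :
  wp c1 h T1 (fun h' => wp c2 h' T2 Q) -> wp (SSeq c1 c2) h (T1 + T2) Q.
Proof.
move=> wp1 cw hf st ag; rewrite /= mulnDl in cw.
have [|t1 [st1 [h1 [ex1 t1T ag1 hf1 wp2]]]] := wp1 _ hf st ag.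
  exact: leq_trans (leq_addr _ _) cw.
have [|t2 [st2 [h2 [ex2 t2T ag2 hf2 q]]]] := wp2 _ hf1 st1 ag1.
  exact: leq_trans (leq_addl _ _) cw.
exists (t1 + t2), st2, h2; split=> //; last exact: leq_add.
exact: ExecSeq ex1 ex2.
Qed.

Lemma wp_assign (x : nat) (e : expr) (h : state) (Q : state -> Prop) :
  eval h e < 2 ^ (K * beta) -> Q (set_reg h x (eval h e)) ->
  wp (SAssign x e) h (scost (SAssign x e)) Q.
Proof.
move=> vK q cw hf st ag; rewrite /= mulSn mulnDl in cw.
have [|st1 [ex1 ag1 _ val1]] := exec_cexpr (e := e) 0 hf ag; first lia.
set st2 := set_reg st1 (tmp 1) 0.
have ag2 : agree st2 h by exact: agree_tmp.
have ev : eval_binop Add (regs st2 (tmp 0)) (regs st2 (tmp 1)) = eval h e.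
  by rewrite /= upd_eq upd_neq // val1 addn0.
exists (ecost e + (1 + 1)), (set_reg st2 (var x) (eval h e)).
exists (set_reg h x (eval h e)); split=> //.
- apply: ExecSeq ex1 _; apply: (ExecSeq (st2 := st2)).
    by apply: ExecConst; rewrite expn_gt0.
  rewrite -ev; apply: ExecOp; rewrite ev; apply: leq_trans vK _.
  by rewrite leq_exp2l //; lia.
- split=> [|y]; first exact: ag2.1.
  rewrite /= /upd; case: (y =P x) => [->|/eqP yx]; first by rewrite eqxx.
  have /negbTE -> : var y != var x by rewrite /var; lia.
  exact: ag2.2.
- by split=> [y|]; [rewrite /= /upd; case: ifP => // _; exact: hf.1 | exact: hf.2].
Qed.

Lemma wp_store (a e : expr) (h : state) (Q : state -> Prop) :
  eval h e < 2 ^ (K * beta) -> Q (set_mem h (eval h a) (eval h e)) ->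
  wp (SStore a e) h (scost (SStore a e)) Q.
Proof.
move=> vK q cw hf st ag; rewrite /= mulnDl in cw.
have [|st1 [ex1 ag1 _ val1]] := exec_cexpr (e := a) 0 hf ag; first lia.
have [|st2 [ex2 ag2 low2 val2]] := exec_cexpr (e := e) 1 hf ag1; first lia.
exists (ecost a + (ecost e + 1)), (set_mem st2 (eval h a) (eval h e)).
exists (set_mem h (eval h a) (eval h e)); split=> //.
- apply: ExecSeq ex1 _; apply: ExecSeq ex2 _.
  by rewrite -val2 -val1 -(low2 0) //; exact: ExecWrite.
- by split=> [|y] /=; rewrite ?ag2.1 ?ag2.2.
- by split=> [|y]; [exact: hf.1 | rewrite /= /upd; case: ifP => // _; exact: hf.2].
Qed.

Lemma wp_if (e : expr) (c : stmt) (h : state) (T : nat) (Q : state -> Prop) :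
  (eval h e != 0 -> wp c h T Q) -> (eval h e = 0 -> Q h) ->
  wp (SIf e c) h (ecost e + T.+2) Q.
Proof.
move=> wpc q0 cw hf st ag; rewrite /= mulnDl in cw.
have [|st1 [ex1 ag1 _ val1]] := exec_cexpr (e := e) 0 hf ag; first lia.
have [z|nz] := eqVneq (eval h e) 0.
  exists (ecost e + 2), st1, h; split=> //; last exact: q0.
    by apply: ExecSeq ex1 _; apply: ExecIfFalse (ExecSkip _ _); rewrite val1.
  by rewrite leq_add2l.
have [|t2 [st2 [h2 [ex2 t2T ag2 hf2 q]]]] := wpc nz _ hf st1 ag1; first lia.
exists (ecost e + t2.+1), st2, h2; split=> //; last by rewrite leq_add2l; lia.
by apply: ExecSeq ex1 _; apply: ExecIfTrue ex2; rewrite val1.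
Qed.

(** [N] is the exact number of passes and [Inv k] describes the state after [k] of them, so
    termination and the time bound need no separate variant. *)
Lemma wp_while (Inv : nat -> state -> Prop) (N : nat) (e : expr) (c : stmt)
    (h : state) (Q : state -> Prop) :
  (forall k h', k < N -> Inv k h' ->
     eval h' e != 0 /\ (fits h' -> wp c h' (scost c) (Inv k.+1))) ->
  (forall h', fits h' -> Inv N h' -> eval h' e = 0 /\ Q h') ->
  Inv 0 h -> wp (SWhile e c) h (wcost N e c) Q.
Proof.
rewrite /wcost; set Tb := scost c.
move=> step stop inv0 cw hf st ag; rewrite /= mulnDl in cw.
have [|st1 [ex1 ag1 _ val1]] := exec_cexpr (e := e) 0 hf ag; first lia.
suff loop d k h1 st2 : k + d = N -> Inv k h1 -> fits h1 -> agree st2 h1 ->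
    regs st2 (tmp 0) = eval h1 e ->
    exists t st' h', [/\
      exec w (While (tmp 0) (Seq (compile c) (cexpr 0 e))) st2 t st',
      t <= (d * (Tb + ecost e).+1).+1, agree st' h', fits h' & Q h'].
  have [t [st' [h' [ex tT ag' hf' q]]]] := loop N 0 h st1 (add0n N) inv0 hf ag1 val1.
  exists (ecost e + t), st', h'; split=> //; last by rewrite leq_add2l.
  exact: ExecSeq ex1 ex.
elim: d k h1 st2 => [|d ih] k h1 st2 kd inv hf1 ag2 val2.
  rewrite addn0 in kd; rewrite kd in inv; have [z q] := stop h1 hf1 inv.
  by exists 1, st2, h1; split=> //; apply: ExecWhileFalse; rewrite val2.
have [|nz wpc] := step k h1 _ inv; first by rewrite -kd; lia.
have [|t3 [st3 [h3 [ex3 t3T ag3 hf3 inv3]]]] := wpc hf1 _ hf1 st2 ag2; first lia.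
have [|st4 [ex4 ag4 _ val4]] := exec_cexpr (e := e) 0 hf3 ag3; first lia.
have [|t5 [st5 [h5 [ex5 t5T ag5 hf5 q]]]] := ih k.+1 h3 st4 _ inv3 hf3 ag4 val4.
  by rewrite -kd addSnnS.
exists (t3 + ecost e + t5).+1, st5, h5; split=> //.
  apply: ExecWhileTrue ex5; first by rewrite val2.
  exact: ExecSeq ex3 ex4.
by rewrite mulSn; lia.
Qed.

Lemma wp_seqc (c1 c2 : stmt) (h : state) (Q : state -> Prop) :
  wp c1 h (scost c1) (fun h' => wp c2 h' (scost c2) Q) ->
  wp (SSeq c1 c2) h (scost (SSeq c1 c2)) Q.
Proof. exact: wp_seq. Qed.

Lemma wp_ifc (e : expr) (c : stmt) (h : state) (Q : state -> Prop) :
  (eval h e != 0 -> wp c h (scost c) Q) -> (eval h e = 0 -> Q h) ->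
  wp (SIf e c) h (scost (SIf e c)) Q.
Proof. exact: wp_if. Qed.

End Width.

(** * Levels, windows and the dynamic program *)

Lemma sum_ord_mul (a b : nat) (F : nat -> nat) :
  \sum_(i < a * b) F i = \sum_(i < a) \sum_(j < b) F (i * b + j).
Proof.
elim: a => [|a ih]; first by rewrite !big_ord0.
by rewrite big_ord_recr /= -ih mulSnr big_split_ord.
Qed.

Lemma leq_sum_term (N : nat) (F : nat -> nat) (i : nat) :
  i < N -> F i <= \sum_(k < N) F k.
Proof. by move=> iN; rewrite (bigD1 (Ordinal iN)) //= leq_addr. Qed.

Lemma sum_delta (N : nat) (F : nat -> nat) (j : nat) :
  j < N -> \sum_(k < N) (k == j :> nat) * F k = F j.
Proof.
move=> jN; rewrite (bigD1 (Ordinal jN)) //= eqxx mul1n big1 ?addn0 // => k kj.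
by move: kj; rewrite -val_eqE /= => /negbTE ->.
Qed.

Lemma sum_below (N s : nat) (F : nat -> nat) :
  s <= N -> \sum_(k < N) (k < s) * F k = \sum_(k < s) F k.
Proof.
move=> sN; rewrite (big_ord_widen N F sN) [RHS]big_mkcond /=.
by apply: eq_bigr => k _; case: ifP => _; rewrite ?mul1n.
Qed.

(** * Vectors coded in base [W] *)

Section Radix.

Variable W : nat.

Definition digit (e i : nat) : nat := e %/ W ^ i %% W.

Definition code (m : nat) (u : nat -> nat) : nat := \sum_(i < m) u i * W ^ i.

Lemma code_lt (m : nat) (u : nat -> nat) :
  (forall i, i < m -> u i < W) -> code m u < W ^ m.
Proof.
elim: m => [|m ih] uW; first by rewrite /code big_ord0.
rewrite /code big_ord_recr /= expnS.
have := ih (fun i im => uW i (ltnW im)); have := uW m (ltnSn m).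
rewrite -/(code m u); move: (W ^ m) => X; nia.
Qed.

Lemma digit_code (m : nat) (u : nat -> nat) (i : nat) :
  (forall k, k < m -> u k < W) -> i < m -> digit (code m u) i = u i.
Proof.
elim: m => // m ih uW; rewrite ltnS leq_eqVlt => im.
have uW' k : k < m -> u k < W by move=> km; apply: uW; rewrite ltnW.
have W0 : 0 < W by apply: leq_ltn_trans (uW m (ltnSn m)).
rewrite /digit /code big_ord_recr /= -/(code m u).
case/predU1P: im => [->|im].
  rewrite addnC divnMDl ?expn_gt0 ?W0 // divn_small ?code_lt // addn0.
  by rewrite modn_small // uW.
have -> : W ^ m = W ^ (m - i.+1) * W * W ^ i.
  by rewrite -expnSr -expnD; congr (_ ^ _); lia.
rewrite !mulnA addnC divnMDl ?expn_gt0 ?W0 // modnMDl.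
by rewrite -/(digit _ _) ih.
Qed.

End Radix.

(** * Halving a count along with its distributions over the machines *)

Section Halving.

Variable m : nat.
Hypothesis m_gt0 : 0 < m.

(* The number of size-[t] jobs left at level [l]: [left c 0 = c], and passing
   from level [l] to [l + 1] sets aside at most [m] of them and halves the rest. *)
Definition left (c l : nat) : nat := (c + m.-1) %/ 2 ^ l - m.-1.

Lemma left0 (c : nat) : left c 0 = c.
Proof. by rewrite /left expn0 divn1 addnK. Qed.

Lemma leftS_spec (c l : nat) :
  2 * left c l.+1 <= left c l /\ left c l <= 2 * left c l.+1 + m.
Proof.
rewrite /left expnSr divnMA; move: (_ %/ 2 ^ l) => u.
by rewrite divn2; lia.
Qed.

Lemma left_eq0 (c l : nat) : c < 2 ^ l -> left c l = 0.
Proof.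
move=> cl; apply/eqP; rewrite subn_eq0 -ltnS ltn_divLR ?expn_gt0 //.
by rewrite prednK //; have := m_gt0; move: (2 ^ l) cl => X; nia.
Qed.

(* Takes the units of [x i %/ 2] in the order of [i] until [N] are taken. *)
Definition half_upto (N : nat) (x : nat -> nat) (i : nat) : nat :=
  minn N (\sum_(k < i.+1) x k %/ 2) - minn N (\sum_(k < i) x k %/ 2).

Lemma half_upto_le (N : nat) (x : nat -> nat) (i : nat) :
  2 * half_upto N x i <= x i.
Proof. by rewrite /half_upto big_ord_recr /=; lia. Qed.

Lemma sum_half_upto (N : nat) (x : nat -> nat) (k : nat) :
  \sum_(i < k) half_upto N x i = minn N (\sum_(i < k) x i %/ 2).
Proof.
elim: k => [|k ih]; first by rewrite !big_ord0 minn0.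
by rewrite big_ord_recr /= ih /half_upto big_ord_recr /=; lia.
Qed.

Fixpoint halves (x : nat -> nat) (l : nat) : nat -> nat :=
  if l is l'.+1 then half_upto (left (\sum_(i < m) x i) l) (halves x l') else x.

Lemma sum_halves (x : nat -> nat) (l : nat) :
  \sum_(i < m) halves x l i = left (\sum_(i < m) x i) l.
Proof.
elim: l => [|l ih]; first by rewrite left0.
rewrite [in LHS]/= sum_half_upto; set c := \sum_(i < m) x i in ih *.
(* Rounding down loses at most one unit per machine, so there are enough pairs for [half_upto] to
   reach its target. *)
have lef : left c l <= 2 * (\sum_(i < m) halves x l i %/ 2) + m.
  rewrite -[X in _ <= _ + X]card_ord -sum1_card -ih big_distrr /= -big_split /=.
  by apply: leq_sum => i _; lia.
apply/minn_idPl; move: lef; move: (\sum_(i < m) _) => F.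
by rewrite /left expnSr divnMA; move: (_ %/ 2 ^ l) => u; lia.
Qed.

Definition residue (x : nat -> nat) (l i : nat) : nat :=
  halves x l i - 2 * halves x l.+1 i.

Lemma halvesE (x : nat -> nat) (l i : nat) :
  halves x l i = 2 * halves x l.+1 i + residue x l i.
Proof. by rewrite /residue subnKC //= half_upto_le. Qed.

Lemma sum_residue (x : nat -> nat) (l : nat) :
  \sum_(i < m) residue x l i =
  left (\sum_(i < m) x i) l - 2 * left (\sum_(i < m) x i) l.+1.
Proof.
rewrite -!sum_halves big_distrr /= -[in RHS]/(halves x l.+1).
rewrite (eq_bigr _ (fun (i : 'I_m) _ => halvesE x l i)) big_split /=.
by rewrite addKn.
Qed.

Lemma residue_expand (x : nat -> nat) (L i : nat) : 
  \sum_(l < L) 2 ^ l * residue x l i + 2 ^ L * halves x L i = x i.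
Proof.
elim: L => [|L ih]; first by rewrite big_ord0 expn0 mul1n.
rewrite big_ord_recr -addnA -{}[in RHS]ih; congr (_ + _).
by rewrite [in RHS]halvesE mulnDr expnSr addnC !mulnA.
Qed.

Lemma left_expand (c L : nat) :
  \sum_(l < L) 2 ^ l * (left c l - 2 * left c l.+1) + 2 ^ L * left c L = c.
Proof.
elim: L => [|L ih]; first by rewrite big_ord0 expn0 mul1n left0.
rewrite big_ord_recr -addnA -[in RHS]ih; congr (_ + _).
rewrite expnSr -mulnA -mulnDr subnK //.
by case: (leftS_spec c L).
Qed.

(* A sequence of machines in which [i] occurs [r i] times. *)
Definition spread (r : nat -> nat) : seq nat :=
  flatten [seq nseq (r i) i | i <- iota 0 m].

Lemma sum_spread (r : nat -> nat) (i : nat) : i < m ->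
  \sum_(k < \sum_(j < m) r j) (i == nth 0 (spread r) k) = r i.
Proof.
move=> im.
have big_iota F : \sum_(j <- iota 0 m) F j = \sum_(j < m) F j.
  by rewrite -{1}(subn0 m) -/(index_iota 0 m) big_mkord.
have sz : size (spread r) = \sum_(j < m) r j.
  rewrite size_flatten /shape -map_comp sumnE big_map big_iota.
  by apply: eq_bigr => j _ /=; rewrite size_nseq.
rewrite -{}sz -(big_mkord xpredT (fun k => nat_of_bool (i == nth 0 (spread r) k))).
rewrite -(big_nth 0 xpredT (fun k => nat_of_bool (i == k))) /=.
have -> : \sum_(x <- spread r) (i == x) = count (pred1 i) (spread r).
  rewrite -sum1_count [RHS]big_mkcond /=.
  by apply: eq_bigr => x _; rewrite eq_sym; case: eqP.
rewrite count_flatten -map_comp sumnE big_map big_iota.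
rewrite -[RHS](sum_delta r im).
by apply: eq_bigr => j _ /=; rewrite count_nseq.
Qed.

(** Past the end of [spread r] the default machine 0 is returned; in [choice] this happens only at
    inactive slots. *)
Definition pick (r : nat -> nat) (k : nat) : nat := nth 0 (spread r) k.

Lemma pick_lt (r : nat -> nat) (k : nat) : pick r k < m.
Proof.
rewrite /pick; have [ge|lt] := leqP (size (spread r)) k; first by rewrite nth_default.
have /flattenP[s /mapP[i]] := mem_nth 0 lt.
by rewrite mem_iota add0n => /andP[_ im] -> /nseqP[-> _].
Qed.

End Halving.

(** * Slots, windows and transitions *)

Section Slots.

Variables (m n : nat) (pr num den : nat -> nat).
Hypothesis m_gt0 : 0 < m.
Hypotheses (num_gt0 : forall i, i < m -> 0 < num i)
           (den_gt0 : forall i, i < m -> 0 < den i).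

Definition maxp : nat := \max_(j < n) pr j.
Definition total : nat := \sum_(j < n) pr j.
Definition cnt (t : nat) : nat := \sum_(j < n) (pr j == t).
Definition levels : nat := (trunc_log 2 n).+1.
Definition lsize : nat := maxp.+1 * m.
Definition nslots : nat := levels * lsize.
(** Dominates [2 * maxp * lsize], the load still to come in units of the current level, plus
    [m * maxp] for the distance of a load from its share, plus 1 for rounding. *)
Definition radius : nat := 4 * m * (maxp.+1 * maxp.+1).
Definition width : nat := 2 * radius.

(* [rate i / rates] is the share of machine [i] in the total speed, and
   [wgt i] is inversely proportional to the speed of machine [i]. *)
Definition rate (i : nat) : nat :=
  \prod_(k < m) (if k == i :> nat then num k else den k).
Definition wgt (i : nat) : nat :=
  \prod_(k < m) (if k == i :> nat then den k else num k).
Definition rates : nat := \sum_(i < m) rate i.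
Definition share (i : nat) : nat := total * rate i %/ rates.

(* Slot [q] is one of the [m] places for a job of size [typ q] at level
   [q %/ lsize], and leads from row [q.+1] to row [q].  A state [e] of row [q] codes
   the load vector [vec q e], whose entries lie in windows starting at [low q]. *)
Definition low (q i : nat) : nat := share i %/ 2 ^ (q %/ lsize) - radius.

(** Slots are numbered by level, then by size, then by place. *)
Definition typ (q : nat) : nat := q %/ m %% maxp.+1.
(** Of the [m] places only as many are active as jobs are set aside; an inactive one gets [psize] 0,
    so that all slots have transitions of the same form. *)
Definition act (q : nat) : bool :=
  let l := q %/ lsize in let c := cnt (typ q) in
  q %% m < left m c l - 2 * left m c l.+1.
Definition psize (q : nat) : nat := typ q * act q.
(** Equals 2 exactly when rows [q.+1] and [q] belong to different levels. *)
Definition dbl (q : nat) : nat := (lsize %| q.+1).+1.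

Definition vec (q e i : nat) : nat := digit width e i + low q i.
Definition next (q j e i : nat) : nat := dbl q * vec q.+1 e i + (i == j) * psize q.
(** A product of truth values is a single arithmetic expression for the program. *)
Definition valid (q j e : nat) : nat :=
  \prod_(i < m) ((low q i <= next q j e i) && (next q j e i < low q i + width)).
Definition succ (q j e : nat) : nat :=
  code width m (fun i => next q j e i - low q i).

Lemma lsize_gt0 : 0 < lsize. Proof. by rewrite muln_gt0 m_gt0. Qed.

Lemma width_gt0 : 0 < width.
Proof. by rewrite !muln_gt0 m_gt0. Qed.

Lemma pow_dbl (q : nat) : 2 ^ (q.+1 %/ lsize) = dbl q * 2 ^ (q %/ lsize).
Proof. by rewrite divnS ?lsize_gt0 // expnD /dbl; case: (_ %| _); rewrite ?mul1n. Qed.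

Lemma pr_le (j : nat) : j < n -> pr j <= maxp.
Proof. by move=> jn; rewrite (leq_bigmax (Ordinal jn)). Qed.

Lemma cnt_le (t : nat) : cnt t <= n.
Proof.
by rewrite -[X in _ <= X]card_ord -sum1_card leq_sum // => j _; case: eqP.
Qed.

Lemma n_lt_levels : n < 2 ^ levels. Proof. exact: trunc_log_ltn. Qed.

Lemma validP (q j e : nat) :
  valid q j e != 0 ->
  forall i, i < m -> low q i <= next q j e i < low q i + width.
Proof.
move=> nz i im; move: nz; rewrite /valid (bigD1 (Ordinal im)) //=.
by case: (_ && _).
Qed.

Lemma valid_succ (q j e : nat) :
  (forall i, i < m -> low q i <= next q j e i < low q i + width) ->
  [/\ valid q j e != 0, succ q j e < width ^ m &
      forall i, i < m -> vec q (succ q j e) i = next q j e i].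
Proof.
move=> win; split.
- by rewrite /valid big1 // => i _; rewrite win.
- by apply: code_lt => i /win; lia.
- move=> i im; rewrite /vec digit_code //; last by move=> k /win; lia.
  by rewrite subnK //; case/andP: (win i im).
Qed.

Lemma slot_decode (l t k : nat) : t < maxp.+1 -> k < m ->
  let q := l * lsize + (t * m + k) in
  [/\ q %/ lsize = l, typ q = t & q %% m = k].
Proof.
move=> tp km q.
have small : t * m + k < lsize by rewrite /lsize; nia.
have qE : q = (l * maxp.+1 + t) * m + k by rewrite /q /lsize; nia.
split.
- by rewrite /q divnMDl ?lsize_gt0 // divn_small ?addn0.
- by rewrite /typ qE divnMDl // divn_small // addn0 modnMDl modn_small.
- by rewrite qE modnMDl modn_small.
Qed.

Lemma sum_slots (F : nat -> nat) :
  \sum_(q < nslots) F q =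
  \sum_(l < levels) \sum_(t < maxp.+1) \sum_(k < m) F (l * lsize + (t * m + k)).
Proof.
rewrite /nslots sum_ord_mul; apply: eq_bigr => l _.
by rewrite /lsize (sum_ord_mul _ _ (fun x => F (l * lsize + x))).
Qed.

Definition slot_count (q t : nat) : nat :=
  (typ q == t) * (act q * 2 ^ (q %/ lsize)).

Lemma left_levels (t : nat) : left m (cnt t) levels = 0.
Proof. by apply: left_eq0 => //; apply: leq_ltn_trans (cnt_le t) n_lt_levels. Qed.

Lemma sum_slot_count (t : nat) : t <= maxp ->
  \sum_(q < nslots) slot_count q t = cnt t.
Proof.
move=> tp; rewrite (sum_slots (slot_count^~ t)).
rewrite -[RHS](left_expand m_gt0 _ levels) left_levels muln0 addn0.
apply: eq_bigr => l _; rewrite (bigD1 (Ordinal (tp : t < maxp.+1))) //=.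
rewrite [X in _ + X]big1 ?addn0 => [|u ut].
  set s := _ - _; have sm : s <= m by have [] := leftS_spec m_gt0 (cnt t) l; rewrite /s; lia.
  transitivity (\sum_(k < m) (k < s) * 2 ^ l).
    apply: eq_bigr => k _.
    have [ql qt qk] := slot_decode l (tp : t < maxp.+1) (ltn_ord k).
    by rewrite /slot_count /act qt ql qk eqxx mul1n.
  by rewrite (sum_below (fun=> 2 ^ l) sm) sum_nat_const card_ord mulnC.
apply: big1 => k _.
have [_ qt _] := slot_decode l (ltn_ord u) (ltn_ord k).
by rewrite /slot_count qt; move: ut; rewrite -val_eqE /= => /negbTE ->.
Qed.

(** * The path of a given distribution through the rows *)

Section Walk.

Variable x : nat -> nat -> nat.
Hypothesis x_cnt : forall t, t <= maxp -> \sum_(i < m) x t i = cnt t.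

Definition vload (i : nat) : nat := \sum_(t < maxp.+1) t * x t i.

Definition choice (q : nat) : nat :=
  pick m (residue m (x (typ q)) (q %/ lsize)) (q %% m).

(** The load that the slots below [q] will still bring to machine [i], counted with the full weights
    [2 ^ l] of their levels. *)
Definition rest (q i : nat) : nat :=
  \sum_(q' < q) (i == choice q') * psize q' * 2 ^ (q' %/ lsize).

Lemma restS (q i : nat) :
  rest q.+1 i = rest q i + (i == choice q) * psize q * 2 ^ (q %/ lsize).
Proof. by rewrite /rest big_ord_recr. Qed.

Lemma rest_nslots (i : nat) : i < m -> rest nslots i = vload i.
Proof.
move=> im.
rewrite /rest (sum_slots (fun q => (i == choice q) * psize q * 2 ^ (q %/ lsize))).
rewrite exchange_big /=; apply: eq_bigr => t _.
(* Nothing survives all the halvings, because [2 ^ levels] exceeds every count. *)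
have xL : halves m (x t) levels i = 0.
  apply/eqP; rewrite -leqn0 -(left_levels t) -(x_cnt (ltn_ord t)) -sum_halves //.
  exact: leq_sum_term.
rewrite -(residue_expand m_gt0 (x t) levels i) xL muln0 addn0 big_distrr /=.
apply: eq_bigr => l _.
rewrite -(sum_spread (residue m (x t) l) im) sum_residue // x_cnt; last first.
  by rewrite -ltnS.
set s := _ - _; have sm : s <= m by have [] := leftS_spec m_gt0 (cnt t) l; rewrite /s; lia.
rewrite -(sum_below (fun k => nat_of_bool (i == nth 0 _ k)) sm) !big_distrr /=.
apply: eq_bigr => k _.
have [ql qt qk] := slot_decode l (ltn_ord t) (ltn_ord k).
rewrite /choice /psize /act qt ql qk -/s /pick.
by rewrite mulnAC !mulnA; lia.
Qed.

Lemma rest_le (q i : nat) : rest q i <= maxp * (2 * lsize) * 2 ^ (q %/ lsize).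
Proof.
have psz q' : (i == choice q') * psize q' <= maxp.
  have : typ q' <= maxp by rewrite -ltnS /typ ltn_pmod.
  by rewrite /psize; case: (_ == _); case: (act q') => /=; lia.
(* Within a level the middle factor grows from [lsize] towards [2 * lsize]; at the next level the
   unit doubles and the factor starts again from [lsize]. This is the geometric sum in inductive
   form. *)
suff le_rest : rest q i <= maxp * (lsize + q %% lsize) * 2 ^ (q %/ lsize).
  apply: leq_trans le_rest _; rewrite leq_mul2r leq_mul2l mul2n -addnn leq_add2l.
  by rewrite (ltnW (ltn_pmod _ lsize_gt0)) !orbT.
elim: q => [|q ih]; first by rewrite /rest big_ord0.
rewrite restS pow_dbl /dbl; move: ih (psz q).
set a := (i == _) * _; set D := 2 ^ (q %/ lsize); set r := rest q i => rD aP.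
have aD : a * D <= maxp * D by rewrite leq_mul2r aP orbT.
apply: leq_trans (leq_add rD aD) _; rewrite modnS; case: ifP => /= [dv|_].
  have -> : q %% lsize = lsize.-1.
    have := divn_eq q lsize; have := divn_eq q.+1 lsize.
    by rewrite divnS ?lsize_gt0 // modnS dv; have := lsize_gt0; nia.
  by rewrite addn0; have := lsize_gt0; case: lsize => //= k _; nia.
by rewrite mul1n -mulnDl leq_mul2r addnS mulnS [maxp + _]addnC leqnn orbT.
Qed.

Definition near (u : nat -> nat) : Prop :=
  forall i, i < m -> u i <= share i + m * maxp /\ share i <= u i + m * maxp.

Lemma near_window (q i v r u : nat) :
  v * 2 ^ (q %/ lsize) + r = u -> r <= maxp * (2 * lsize) * 2 ^ (q %/ lsize) ->
  u <= share i + m * maxp -> share i <= u + m * maxp ->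
  low q i <= v < low q i + width.
Proof.
rewrite /low; have : 0 < 2 ^ (q %/ lsize) by rewrite expn_gt0.
move: (2 ^ _) (share i) => D h D0 <- rD uh hu.
have hD1 := leq_trunc_div h D; have := ltn_ceil h D0.
move: hD1; set k := h %/ D => hD1 hD2.
have radP : 2 * maxp * lsize + m * maxp + 1 <= radius.
  by rewrite /radius /lsize; move: maxp m_gt0 => p; nia.
have vk : v < k + 1 + m * maxp.
  rewrite -(ltn_pmul2r D0); apply: leq_ltn_trans (leq_addr r _) _.
  by apply: leq_ltn_trans uh _; nia.
have kv : k <= v + 2 * maxp * lsize + m * maxp.
  by rewrite -(leq_pmul2r D0); apply: leq_trans hD1 _; nia.
(* Where the subtraction in [low] is cut off at 0, the upper end of the window only moves up. *)
by rewrite /width; lia.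
Qed.

Lemma rates_gt0 : 0 < rates.
Proof.
rewrite /rates (bigD1 (Ordinal m_gt0)) //= ltn_addr // prodn_gt0 // => k.
by case: ifP => _; [apply: num_gt0 | apply: den_gt0].
Qed.

Lemma total_le : total <= n * maxp.
Proof.
rewrite -[X in X * _](card_ord n) -sum_nat_const leq_sum // => j _.
exact: pr_le.
Qed.

Lemma share_le (i : nat) : i < m -> share i <= total.
Proof.
move=> im; rewrite -[X in _ <= X](mulnK total rates_gt0).
by rewrite leq_div2r // leq_mul2l leq_sum_term ?orbT.
Qed.

(** The path starts at the zero vector, which thereby gets code 0 in the top row. A share is at most
    [n * maxp], and dividing it by [2 ^ levels > n] leaves at most [maxp], which is below the
    radius. *)
Lemma low_nslots (i : nat) : i < m -> low nslots i = 0.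
Proof.
move=> im; apply/eqP; rewrite subn_eq0 /nslots mulnK ?lsize_gt0 //.
apply: leq_trans (leq_div2r _ (leq_trans (share_le im) total_le)) _.
apply: (@leq_trans maxp); last by rewrite /radius; move: maxp m_gt0 => p; nia.
by rewrite -ltnS ltn_divLR ?expn_gt0 //; have := n_lt_levels; nia.
Qed.

Lemma vec_nslots (i : nat) : i < m -> vec nslots 0 i = 0.
Proof. by move=> im; rewrite /vec /digit div0n mod0n low_nslots. Qed.

(** Following [choice] downward, the vector of row [q] is forced by the equation that it and
    [rest q] make up [vload]. That equation alone places it in its window, so every step of the path
    is valid and closure carries reachability to row 0. *)
Lemma walk_reach (T : nat -> nat -> nat) :
  near vload -> T nslots 0 != 0 ->
  (forall q j e, q < nslots -> j < m -> e < width ^ m ->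
     T q.+1 e != 0 -> valid q j e != 0 -> T q (succ q j e) != 0) ->
  exists e, [/\ e < width ^ m, T 0 e != 0 & forall i, i < m -> vec 0 e i = vload i].
Proof.
move=> nearV T0 closed.
suff walk u q : q + u = nslots -> exists e, [/\ e < width ^ m, T q e != 0 &
    forall i, i < m -> vec q e i * 2 ^ (q %/ lsize) + rest q i = vload i].
  have [e [eW Te eV]] := walk nslots 0 (add0n _); exists e; split=> // i im.
  by rewrite -(eV i im) div0n muln1 /rest big_ord0 addn0.
elim: u q => [|u ih] q qu.
  exists 0; rewrite expn_gt0 width_gt0 -(addn0 q) qu; split=> // i im.
  by rewrite vec_nslots // rest_nslots.
have [|e [eW Te eV]] := ih q.+1; first by rewrite -qu addSnnS.
have jm : choice q < m by exact: pick_lt.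
have qn : q < nslots by rewrite -qu; lia.
have eV' i : i < m -> next q (choice q) e i * 2 ^ (q %/ lsize) + rest q i = vload i.
  by move=> im; rewrite -(eV i im) restS pow_dbl /next; lia.
have [|v_ok v_lt v_vec] := @valid_succ q (choice q) e.
  move=> i im; have [uh hu] := nearV i im.
  exact: near_window (eV' i im) (rest_le q i) uh hu.
exists (succ q (choice q) e); split=> //; first exact: closed.
by move=> i im; rewrite v_vec // eV'.
Qed.

End Walk.

(** * Balanced schedules suffice *)

Definition mload (s : nat -> nat) (i : nat) : nat := \sum_(j < n) (s j == i) * pr j.

Definition cost (u : nat -> nat) : nat := \max_(i < m) u i * wgt i.

(** Only an upper bound: no machine exceeds its share of the work [total + m * maxp]. *)
Definition good (u : nat -> nat) : Prop :=
  forall i, i < m -> u i * rates <= rate i * (total + m * maxp).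

Lemma sum_mload (s : nat -> nat) :
  (forall j, j < n -> s j < m) -> \sum_(i < m) mload s i = total.
Proof.
move=> sm; rewrite exchange_big; apply: eq_bigr => j _ /=.
rewrite -[RHS](sum_delta (fun=> pr j) (sm j (ltn_ord j))).
by apply: eq_bigr => i _; rewrite eq_sym.
Qed.

(** The lower bound on machine [i] follows from the upper bounds on all the others, because the
    loads add up to [total]. *)
Lemma good_near (s : nat -> nat) :
  (forall j, j < n -> s j < m) -> good (mload s) -> near (mload s).
Proof.
move=> sm gd i im; set E := m * maxp.
have rate_le : rate i <= rates by exact: leq_sum_term.
have R0 := rates_gt0.
have hR1 : share i * rates <= total * rate i by exact: leq_trunc_div.
have hR2 : total * rate i < (share i).+1 * rates by exact: ltn_ceil.
have up := gd i im; rewrite -/E in up.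
have lo : total * rate i <= (mload s i + E) * rates.
  have sumV := sum_mload sm; rewrite (bigD1 (Ordinal im)) //= in sumV.
  have sumR : rates = rate i + \sum_(k < m | k != Ordinal im) rate k.
    by rewrite /rates (bigD1 (Ordinal im)).
  have : (\sum_(k < m | k != Ordinal im) mload s k) * rates <=
         (\sum_(k < m | k != Ordinal im) rate k) * (total + E).
    by rewrite !big_distrl /=; apply: leq_sum => k _; exact: gd.
  move: sumV sumR; move: (\sum_(_ < _ | _) _) (\sum_(_ < _ | _) _) => A B.
  by move: total rates (rate i) (mload s i) => t r ri v <- ->; nia.
split.
  rewrite -ltnS -(ltn_pmul2r R0); apply: leq_ltn_trans up _; nia.
rewrite -(leq_pmul2r R0); exact: leq_trans hR1 lo.
Qed.

(** Jobs are placed one by one wherever the bound survives. If every machine refused job [k], adding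
    the [m] strict inequalities would make the placed work plus [m * pr k] exceed
    [total + m * maxp]. *)
Lemma greedy : exists s, (forall j, j < n -> s j < m) /\ good (mload s).
Proof.
pose ld k (s : nat -> nat) i := \sum_(j < k) (s j == i) * pr j.
suff list k : k <= n -> exists s : nat -> nat, (forall j, s j < m) /\
    forall i, i < m -> ld k s i * rates <= rate i * (total + m * maxp).
  by have [s [sm gd]] := list n (leqnn n); exists s; split=> // j _.
elim: k => [|k ih] kn.
  by exists (fun=> 0); split=> // i _; rewrite /ld big_ord0.
have [s [sm gd]] := ih (ltnW kn).
have [i im fit] : exists2 i, i < m &
    (ld k s i + pr k) * rates <= rate i * (total + m * maxp).
  have [i fit|none] := pickP (fun i : 'I_m =>
      (ld k s i + pr k) * rates <= rate i * (total + m * maxp)).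
    by exists i.
  have ld_le : \sum_(i < m) ld k s i <= total.
    rewrite exchange_big /total /=.
    rewrite [X in X <= _](big_ord_widen n (fun j => \sum_(i < m) (s j == i) * pr j) (ltnW kn)).
    rewrite [X in X <= _]big_mkcond /=; apply: leq_sum => j _; case: ifP => // _.
    rewrite -{2}(sum_delta (fun=> pr j) (sm j)).
    by apply: leq_sum => i _; rewrite eq_sym.
  have : \sum_(i < m) (rate i * (total + m * maxp) + 1) <=
         \sum_(i < m) (ld k s i + pr k) * rates.
    by apply: leq_sum => i _; rewrite addn1 ltnNge none.
  rewrite -big_distrl !big_split /= -big_distrl /= -/rates sum1_card sum_nat_const.
  have mp : m * pr k <= m * maxp by rewrite leq_mul2l pr_le ?orbT.
  rewrite card_ord => le; exfalso; move: (leq_add ld_le mp) le m_gt0.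
  by move: (_ + _) (total + _) rates => a b r ab; nia.
exists (fun j => if j == k then i else s j); split=> [j|i' i'm].
  by case: ifP.
rewrite /ld big_ord_recr /= eqxx.
rewrite (eq_bigr (fun j : 'I_k => (s j == i') * pr j)) => [|j _]; last first.
  by rewrite (ltn_eqF (ltn_ord j)).
rewrite -/(ld k s i'); case: eqP => [<-|_]; first by rewrite mul1n.
by rewrite mul0n addn0 gd.
Qed.

Lemma wgt_rate (i : nat) : wgt i * rate i = \prod_(k < m) (num k * den k).
Proof.
rewrite /wgt /rate -big_split /=; apply: eq_bigr => k _.
by case: eqP; rewrite 1?mulnC.
Qed.

Lemma leq_cost (u : nat -> nat) (i : nat) : i < m -> u i * wgt i <= cost u.
Proof. by move=> im; rewrite /cost (leq_bigmax (Ordinal im)). Qed.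

(** Since [wgt i * rate i] is the same for all machines, the threshold in [good] is one common
    completion time. A schedule violating it somewhere costs more than the greedy one, which
    respects it everywhere. *)
Lemma good_enough (s : nat -> nat) : (forall j, j < n -> s j < m) ->
  exists s', [/\ forall j, j < n -> s' j < m, good (mload s') &
                 cost (mload s') <= cost (mload s)].
Proof.
move=> sm; set C := total + m * maxp.
have [/forallP ok|] := boolP [forall i : 'I_m, mload s i * rates <= rate i * C].
  by exists s; split=> // i im; exact: (ok (Ordinal im)).
rewrite negb_forall => /existsP[i]; rewrite -ltnNge => bad.
have [s' [s'm gd]] := greedy; exists s'; split=> //.
apply/bigmax_leqP => k _; apply: leq_trans (leq_cost _ (ltn_ord i)).
rewrite -(leq_pmul2r rates_gt0) mulnAC.
apply: (@leq_trans (rate k * C * wgt k)); first by rewrite leq_mul2r gd ?orbT.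
have -> : rate k * C * wgt k = wgt i * (rate i * C).
  by rewrite mulnA wgt_rate -(wgt_rate k); lia.
have -> : mload s i * wgt i * rates = wgt i * (mload s i * rates) by lia.
by rewrite leq_mul2l ltnW ?orbT.
Qed.

Lemma sum_xcnt (s : nat -> nat) (t : nat) : (forall j, j < n -> s j < m) ->
  \sum_(i < m) \sum_(j < n) (pr j == t) * (s j == i) = cnt t.
Proof.
move=> sm; rewrite exchange_big; apply: eq_bigr => j _ /=.
rewrite -[RHS](sum_delta (fun=> nat_of_bool (pr j == t)) (sm j (ltn_ord j))).
by apply: eq_bigr => i _; rewrite [s _ == _]eq_sym mulnC.
Qed.

Lemma vload_xcnt (s : nat -> nat) (i : nat) :
  \sum_(t < maxp.+1) t * (\sum_(j < n) (pr j == t) * (s j == i)) = mload s i.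
Proof.
under eq_bigr do rewrite big_distrr /=.
rewrite exchange_big; apply: eq_bigr => j _ /=.
have pj : pr j < maxp.+1 by rewrite ltnS pr_le.
rewrite -(sum_delta (fun t => (s j == i) * t) pj).
by apply: eq_bigr => t _; rewrite [pr _ == _]eq_sym mulnCA; congr (_ * _); exact: mulnC.
Qed.

End Slots.

(** * The program *)

Declare Scope expr_scope.
Delimit Scope expr_scope with X.
Bind Scope expr_scope with expr.
Notation "a + b" := (Bin Add a b) : expr_scope.
Notation "a - b" := (Bin Sub a b) : expr_scope.
Notation "a * b" := (Bin Mul a b) : expr_scope.
Notation "a / b" := (Bin Div a b) : expr_scope.
Notation "a %% b" := (Bin Mod a b) : expr_scope.
Notation "a < b" := (Bin Lt a b) : expr_scope.
Notation "a == b" := (Bin Eq a b) : expr_scope.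

Fixpoint esum (k : nat) (f : nat -> expr) : expr :=
  if k is k'.+1 then (esum k' f + f k')%X else Num 0.

Fixpoint eprod (k : nat) (f : nat -> expr) : expr :=
  if k is k'.+1 then (eprod k' f * f k')%X else Num 1.

(** With truncated subtraction, [b + (a - b)] is the maximum of [a] and [b]. *)
Fixpoint emax (k : nat) (f : nat -> expr) : expr :=
  if k is k'.+1 then (f k' + (emax k' f - f k'))%X else Num 0.

Definition epow (e : expr) (k : nat) : expr := eprod k (fun=> e).

Lemma eval_esum (h : state) (k : nat) (f : nat -> expr) :
  eval h (esum k f) = \sum_(i < k) eval h (f i).
Proof. by elim: k => [|k ih]; rewrite ?big_ord0 // big_ord_recr /= ih. Qed.

Lemma eval_eprod (h : state) (k : nat) (f : nat -> expr) :
  eval h (eprod k f) = \prod_(i < k) eval h (f i).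
Proof. by elim: k => [|k ih]; rewrite ?big_ord0 // big_ord_recr /= ih. Qed.

Lemma eval_emax (h : state) (k : nat) (f : nat -> expr) :
  eval h (emax k f) = \max_(i < k) eval h (f i).
Proof. by elim: k => [|k ih]; rewrite ?big_ord0 // big_ord_recr /= ih maxnC maxnE. Qed.

Lemma eval_epow (h : state) (e : expr) (k : nat) :
  eval h (epow e k) = eval h e ^ k.
Proof. by rewrite eval_eprod prod_nat_const card_ord. Qed.

Section Program.

Variable m : nat.

Variables (n : nat) (pr num den : nat -> nat).
Hypotheses (m_gt0 : 0 < m) (n_gt0 : 0 < n).

Local Notation maxp := (maxp n pr).
Local Notation total := (total n pr).
Local Notation cnt := (cnt n pr).
Local Notation levels := (levels n).
Local Notation lsize := (lsize m n pr).
Local Notation nslots := (nslots m n pr).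
Local Notation radius := (radius m n pr).
Local Notation width := (width m n pr).
Local Notation rate := (rate m num den).
Local Notation wgt := (wgt m num den).
Local Notation rates := (rates m num den).
Local Notation share := (share m n pr num den).
Local Notation low := (low m n pr num den).
Local Notation typ := (typ m n pr).
Local Notation act := (act m n pr).
Local Notation dbl := (dbl m n pr).
Local Notation vec := (vec m n pr num den).
Local Notation next := (next m n pr num den).
Local Notation valid := (valid m n pr num den).
Local Notation succ := (succ m n pr num den).
Local Notation cost := (cost m num den).

(* Variables: 0 is a loop counter, 1 holds [maxp], 2 [total], 3 [levels],
   5 a state of the dynamic program, 4 is scratch.  Memory: the input is followed
   by the histogram [cnt], the powers of 2, the table of the dynamic program,
   with one row per slot, and the numbers of jobs of each size on each machine. *)
Definition hbase : nat := n + (1 + 2 * m).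
Definition pbase : nat := hbase + (maxp + 1).
Definition tbase : nat := pbase + (levels + 1).
Definition xbase : nat := tbase + (nslots + 1) * width ^ m.

(** Established by the counting and power phases, and preserved by all later ones. *)
Definition static (h : state) : Prop :=
  [/\ mem h 0 = n, regs h 1 = maxp, regs h 2 = total, regs h 3 = levels &
  [/\ forall i, i < m -> mem h (n + (1 + 2 * i)) = num i,
      forall i, i < m -> mem h (n + (2 + 2 * i)) = den i,
      forall t, t <= maxp -> mem h (hbase + t) = cnt t
    & forall l, l <= levels -> mem h (pbase + l) = 2 ^ l]].

(* Once its value is known, each expression is made opaque so that [/=] stops at it. *)
Section Eval.

Variable h : state.
Hypothesis st : static h.

Definition eN : expr := Fetch (Num 0).

(** The variants whose names end in 0 serve the first two phases, where [static] does not hold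
    yet. *)
Lemma eval_eN0 (h' : state) : mem h' 0 = n -> eval h' eN = n.
Proof. by []. Qed.

Lemma eval_eN : eval h eN = n. Proof. by case: st. Qed.
#[global] Opaque eN.

Definition eP : expr := Var 1.

Lemma eval_eP : eval h eP = maxp. Proof. by case: st. Qed.
#[global] Opaque eP.

Definition eS : expr := Var 2.

Lemma eval_eS : eval h eS = total. Proof. by case: st. Qed.
#[global] Opaque eS.

Definition eL : expr := Var 3.

Lemma eval_eL : eval h eL = levels. Proof. by case: st. Qed.
#[global] Opaque eL.

Definition eNum (i : nat) : expr := Fetch (eN + Num (1 + 2 * i)).

Lemma eval_eNum (i : nat) : i < m -> eval h (eNum i) = num i.
Proof. by case: (st) => _ _ _ _ [numE _ _ _] im; rewrite /= eval_eN numE. Qed.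
#[global] Opaque eNum.

Definition eDen (i : nat) : expr := Fetch (eN + Num (2 + 2 * i)).

Lemma eval_eDen (i : nat) : i < m -> eval h (eDen i) = den i.
Proof. by case: (st) => _ _ _ _ [_ denE _ _] im; rewrite /= eval_eN denE. Qed.
#[global] Opaque eDen.

Definition eRate (i : nat) : expr := eprod m (fun k => if k == i then eNum k else eDen k).

Lemma eval_eRate (i : nat) : eval h (eRate i) = rate i.
Proof.
rewrite eval_eprod; apply: eq_bigr => k _.
by case: eqP => _; rewrite (eval_eNum, eval_eDen).
Qed.
#[global] Opaque eRate.

Definition eWgt (i : nat) : expr := eprod m (fun k => if k == i then eDen k else eNum k).

Lemma eval_eWgt (i : nat) : eval h (eWgt i) = wgt i.
Proof.
rewrite eval_eprod; apply: eq_bigr => k _.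
by case: eqP => _; rewrite (eval_eNum, eval_eDen).
Qed.
#[global] Opaque eWgt.

Definition eRates : expr := esum m eRate.
Definition eShare (i : nat) : expr := (eS * eRate i) / eRates.

Lemma eval_eShare (i : nat) : eval h (eShare i) = share i.
Proof.
rewrite [LHS]/= eval_eS eval_eRate eval_esum; congr (_ %/ _).
by apply: eq_bigr => k _; rewrite eval_eRate.
Qed.
#[global] Opaque eShare.

Definition eLs : expr := (eP + Num 1) * Num m.

Lemma eval_eLs : eval h eLs = lsize.
Proof. by rewrite [LHS]/= eval_eP addn1. Qed.
#[global] Opaque eLs.

Definition eQ : expr := eL * eLs.

Lemma eval_eQ : eval h eQ = nslots.
Proof. by rewrite [LHS]/= eval_eL eval_eLs. Qed.
#[global] Opaque eQ.

Definition eRad : expr := Num (4 * m) * ((eP + Num 1) * (eP + Num 1)).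
Definition eWid : expr := Num 2 * eRad.

Lemma eval_eWid : eval h eWid = width.
Proof. by rewrite [LHS]/= eval_eP addn1. Qed.
#[global] Opaque eWid.

Definition eWm : expr := epow eWid m.

Lemma eval_eWm : eval h eWm = width ^ m.
Proof. by rewrite eval_epow eval_eWid. Qed.
#[global] Opaque eWm.

Definition eHB : expr := eN + Num (1 + 2 * m).

Lemma eval_eHB0 (h' : state) : mem h' 0 = n -> eval h' eHB = hbase.
Proof. by move=> n0; rewrite [LHS]/= eval_eN0. Qed.

Lemma eval_eHB : eval h eHB = hbase.
Proof. by rewrite [LHS]/= eval_eN. Qed.
#[global] Opaque eHB.

Definition ePB : expr := eHB + (eP + Num 1).

Lemma eval_ePB0 (h' : state) :
  mem h' 0 = n -> regs h' 1 = maxp -> eval h' ePB = pbase.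
Proof. by move=> n0 p1; rewrite [LHS]/= eval_eHB0 // -[eval h' eP]/(regs h' 1) p1. Qed.

Lemma eval_ePB : eval h ePB = pbase.
Proof. by rewrite [LHS]/= eval_eHB eval_eP. Qed.
#[global] Opaque ePB.

Definition eTB : expr := ePB + (eL + Num 1).

Lemma eval_eTB : eval h eTB = tbase.
Proof. by rewrite [LHS]/= eval_ePB eval_eL. Qed.
#[global] Opaque eTB.

Definition eXB : expr := eTB + (eQ + Num 1) * eWm.

Lemma eval_eXB : eval h eXB = xbase.
Proof. by rewrite [LHS]/= eval_eTB eval_eQ eval_eWm. Qed.
#[global] Opaque eXB.

Definition ePw (l : expr) : expr := Fetch (ePB + l).

Lemma eval_ePw0 (h' : state) (l : expr) :
  mem h' 0 = n -> regs h' 1 = maxp ->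
  eval h' (ePw l) = mem h' (pbase + eval h' l).
Proof. by move=> n0 p1; rewrite [LHS]/= eval_ePB0. Qed.

Lemma eval_ePw (l : expr) : eval h l <= levels -> eval h (ePw l) = 2 ^ eval h l.
Proof. by case: (st) => _ _ _ _ [_ _ _ pw] le; rewrite [LHS]/= eval_ePB pw. Qed.
#[global] Opaque ePw.

Definition eLow (q : expr) (i : nat) : expr := eShare i / ePw (q / eLs) - eRad.

Lemma eval_eLow (q : expr) (i : nat) :
  eval h q <= nslots -> eval h (eLow q i) = low (eval h q) i.
Proof.
move=> qn; rewrite [LHS]/= eval_eShare eval_ePw /= eval_eLs ?eval_eP ?addn1 //.
by rewrite -(mulnK levels (lsize_gt0 n pr m_gt0)) leq_div2r.
Qed.
#[global] Opaque eLow.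

Definition eTyp (q : expr) : expr := (q / Num m) %% (eP + Num 1).

Lemma eval_eTyp (q : expr) : eval h (eTyp q) = typ (eval h q).
Proof. by rewrite [LHS]/= eval_eP addn1. Qed.
#[global] Opaque eTyp.

Definition eLeft (c pw : expr) : expr := (c + Num m.-1) / pw - Num m.-1.
Definition eAct (q : expr) : expr :=
  (q %% Num m) < (eLeft (Fetch (eHB + eTyp q)) (ePw (q / eLs))
                  - Num 2 * eLeft (Fetch (eHB + eTyp q)) (ePw (q / eLs + Num 1))).

Lemma eval_eAct (q : expr) :
  eval h q < nslots -> eval h (eAct q) = act (eval h q).
Proof.
move=> qn.
have ql : eval h q %/ lsize < levels by rewrite ltn_divLR ?lsize_gt0.
have tl : typ (eval h q) <= maxp by rewrite -ltnS ltn_pmod.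
case: (st) => _ _ _ _ [_ _ hist _].
rewrite [LHS]/= eval_eHB eval_eTyp hist //.
rewrite !eval_ePw /= eval_eLs ?addn1 //; exact: ltnW.
Qed.
#[global] Opaque eAct.

Definition eDbl (q : expr) : expr := (((q + Num 1) %% eLs) == Num 0) + Num 1.

Lemma eval_eDbl (q : expr) : eval h (eDbl q) = dbl (eval h q).
Proof. by rewrite [LHS]/= eval_eLs !addn1. Qed.
#[global] Opaque eDbl.

Definition eVec (q e : expr) (i : nat) : expr :=
  ((e / epow eWid i) %% eWid) + eLow q i.

Lemma eval_eVec (q e : expr) (i : nat) :
  eval h q <= nslots -> eval h (eVec q e i) = vec (eval h q) (eval h e) i.
Proof. by move=> qn; rewrite [LHS]/= eval_eLow // eval_epow eval_eWid. Qed.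
#[global] Opaque eVec.

Definition eNext (q j e : expr) (i : nat) : expr :=
  eDbl q * eVec (q + Num 1) e i + (Num i == j) * (eTyp q * eAct q).

Lemma eval_eNext (q j e : expr) (i : nat) : eval h q < nslots ->
  eval h (eNext q j e i) = next (eval h q) (eval h j) (eval h e) i.
Proof.
move=> qn; rewrite [LHS]/= eval_eDbl eval_eVec /= ?addn1 //.
by rewrite eval_eTyp eval_eAct.
Qed.
#[global] Opaque eNext.

Definition eValid (q j e : expr) : expr :=
  eprod m (fun i => (eLow q i < eNext q j e i + Num 1) *
                    (eNext q j e i < eLow q i + eWid))%X.

Lemma eval_eValid (q j e : expr) : eval h q < nslots ->
  eval h (eValid q j e) = valid (eval h q) (eval h j) (eval h e).
Proof.
move=> qn; rewrite eval_eprod; apply: eq_bigr => i _.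
by rewrite [LHS]/= eval_eNext // (eval_eLow _ (ltnW qn)) eval_eWid addn1 ltnS mulnb.
Qed.
#[global] Opaque eValid.

Definition eSucc (q j e : expr) : expr :=
  esum m (fun i => (eNext q j e i - eLow q i) * epow eWid i)%X.

Lemma eval_eSucc (q j e : expr) : eval h q < nslots ->
  eval h (eSucc q j e) = succ (eval h q) (eval h j) (eval h e).
Proof.
move=> qn; rewrite eval_esum; apply: eq_bigr => i _.
by rewrite [LHS]/= eval_eNext // (eval_eLow _ (ltnW qn)) eval_epow eval_eWid.
Qed.
#[global] Opaque eSucc.

Definition eTab (q e : expr) : expr := eTB + (q * eWm + e).

Lemma eval_eTab (q e : expr) :
  eval h (eTab q e) = tbase + (eval h q * width ^ m + eval h e).
Proof. by rewrite [LHS]/= eval_eTB eval_eWm. Qed.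
#[global] Opaque eTab.

Definition eCost (e : expr) : expr := emax m (fun i => eVec (Num 0) e i * eWgt i)%X.

Lemma eval_eCost (e : expr) : eval h (eCost e) = cost (vec 0 (eval h e)).
Proof.
rewrite eval_emax; apply: eq_bigr => i _.
by rewrite [LHS]/= eval_eVec //= eval_eWgt.
Qed.
#[global] Opaque eCost.

Definition eX (t i : expr) : expr := eXB + (t * Num m + i).

Lemma eval_eX (t i : expr) : eval h (eX t i) = xbase + (eval h t * m + eval h i).
Proof. by rewrite [LHS]/= eval_eXB. Qed.
#[global] Opaque eX.

Definition eJob : expr := Fetch (Var 0 + Num 1).
(** Branching done by arithmetic: the last machine below [k] that still has a job of size [t]
    wins. *)
Fixpoint eFind (t : expr) (k : nat) : expr :=
  if k is k'.+1 then
    (eFind t k' * (Fetch (eX t (Num k')) == Num 0)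
     + Num k' * (Num 0 < Fetch (eX t (Num k'))))%X
  else Num 0.

(** * The phases of the program *)

Definition incr : stmt := SAssign 0 (Var 0 + Num 1).

Definition count_body : stmt :=
  SSeq (SStore (eHB + eJob) (Fetch (eHB + eJob) + Num 1))
 (SSeq (SAssign 2 (Var 2 + eJob))
 (SSeq (SAssign 1 (eJob + (Var 1 - eJob))) incr)).

Definition count_prog : stmt :=
  SSeq (SAssign 0 (Num 0)) (SSeq (SAssign 1 (Num 0)) (SSeq (SAssign 2 (Num 0))
       (SWhile (Var 0 < eN) count_body))).

Definition pow_body : stmt :=
  SSeq (SStore (ePB + (Var 3 + Num 1)) (Num 2 * ePw (Var 3)))
       (SAssign 3 (Var 3 + Num 1)).

(** Doubling stops at the first power above [n], so variable 3 ends as [levels] without computing a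
    logarithm. *)
Definition pow_prog : stmt :=
  SSeq (SAssign 3 (Num 0)) (SSeq (SStore (ePB + Num 0) (Num 1))
       (SWhile (ePw (Var 3) < eN + Num 1) pow_body)).

Definition eZj : expr := Var 0 %% Num m.
Definition eZe : expr := (Var 0 / Num m) %% eWm.
Definition eZq : expr := Var 0 / Num m / eWm.

(* The counter [(q * width ^ m + e) * m + j] runs downward over all transitions. *)
Definition dp_body : stmt :=
  SSeq (SAssign 0 (Var 0 - Num 1))
       (SIf ((Num 0 < Fetch (eTab (eZq + Num 1) eZe)) * eValid eZq eZj eZe)
            (SStore (eTab eZq (eSucc eZq eZj eZe)) (Var 0 %% (eWm * Num m) + Num 1))).

(** The entry 1 only marks the zero vector of the top row as reachable: backtracking stops there and
    never decodes it. *)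
Definition dp_prog : stmt :=
  SSeq (SStore (eTab eQ (Num 0)) (Num 1))
 (SSeq (SAssign 0 (eQ * eWm * Num m)) (SWhile (Var 0) dp_body)).

(* Variable 4 is the successor of the least cost so far, and 0 if there is none. *)
Definition best_body : stmt :=
  SSeq (SIf ((Num 0 < Fetch (eTab (Num 0) (Var 0))) *
             ((Var 4 == Num 0) + (eCost (Var 0) + Num 1 < Var 4)))
            (SSeq (SAssign 4 (eCost (Var 0) + Num 1)) (SAssign 5 (Var 0))))
       incr.

Definition best_prog : stmt :=
  SSeq (SAssign 4 (Num 0)) (SSeq (SAssign 0 (Num 0)) (SWhile (Var 0 < eWm) best_body)).

Definition eSlotX : expr := eX (eTyp (Var 0)) (Var 4 %% Num m).
Definition back_body : stmt :=
  SSeq (SAssign 4 (Fetch (eTab (Var 0) (Var 5)) - Num 1))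
 (SSeq (SStore eSlotX (Fetch eSlotX + eAct (Var 0) * ePw (Var 0 / eLs)))
 (SSeq (SAssign 5 (Var 4 / Num m)) incr)).

Definition back_prog : stmt :=
  SSeq (SAssign 0 (Num 0)) (SWhile (Var 0 < eQ) back_body).

Definition assign_body : stmt :=
  SSeq (SAssign 4 (eFind eJob m))
 (SSeq (SStore (eX eJob (Var 4)) (Fetch (eX eJob (Var 4)) - Num 1))
 (SSeq (SStore (Var 0 + Num 1) (Var 4)) incr)).

Definition assign_prog : stmt :=
  SSeq (SAssign 0 (Num 0)) (SWhile (Var 0 < eN) assign_body).

Definition prog : stmt :=
  SSeq count_prog (SSeq pow_prog (SSeq dp_prog (SSeq best_prog (SSeq back_prog assign_prog)))).

(* [a], [l], [c], [v], [q]: numbers of jobs, levels, table steps, states, slots. *)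
Definition prog_cost (a l c v q : nat) : nat :=
  (3 + (3 + (3 + wcost a (Var 0 < eN) count_body)))
  + ((3 + (scost (SStore (ePB + Num 0) (Num 1))
           + wcost l (ePw (Var 3) < eN + Num 1) pow_body))
  + ((scost (SStore (eTab eQ (Num 0)) (Num 1))
      + (scost (SAssign 0 (eQ * eWm * Num m)) + wcost c (Var 0) dp_body))
  + ((3 + (3 + wcost v (Var 0 < eWm) best_body))
  + ((3 + wcost q (Var 0 < eQ) back_body)
  + (3 + wcost a (Var 0 < eN) assign_body))))).

End Eval.

(** * Correctness of the phases *)

Hypotheses (num_gt0 : forall i, i < m -> 0 < num i)
           (den_gt0 : forall i, i < m -> 0 < den i).
Variable input : nat -> nat.
Hypotheses (input_n : input 0 = n)
  (input_pr : forall j, j < n -> input j.+1 = pr j)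
  (input_num : forall i, i < m -> input (n + (1 + 2 * i)) = num i)
  (input_den : forall i, i < m -> input (n + (2 + 2 * i)) = den i)
  (input_end : forall a, hbase <= a -> input a = 0).
Variables (K beta w : nat).
Hypothesis beta_gt0 : 0 < beta.
Let B := 2 ^ (K * beta).
Hypotheses (n_lt : n.+1 < B) (total_lt : total < B) (levels_lt : 2 ^ levels < B)
  (table_lt : nslots * width ^ m * m + width ^ m * m + 1 < B)
  (cost_lt : forall i, i < m -> (width + total) * wgt i + 1 < B).

Local Notation wpr := (wp K beta w).

Lemma maxp_le_total : maxp <= total.
Proof. by apply/bigmax_leqP => j _; rewrite /total leq_sum_term. Qed.

(** The memory after [k] jobs have been counted. Cells beyond the input start at 0, so the histogram
    needs no initialization. *)
Definition hist (k a : nat) : nat := input a + \sum_(j < k) (a == hbase + pr j).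

Lemma hist_low (k a : nat) : a < hbase -> hist k a = input a.
Proof.
by move=> ab; rewrite /hist big1 ?addn0 // => j _; case: eqP => // E; lia.
Qed.

Lemma hist_n (k : nat) : hist k 0 = n.
Proof. by rewrite hist_low // /hbase; lia. Qed.

Lemma hist_pr (k j : nat) : j < n -> hist k j.+1 = pr j.
Proof. by move=> jn; rewrite hist_low ?input_pr // /hbase; lia. Qed.

Lemma hist_hbase (k t : nat) : hist k (hbase + t) = \sum_(j < k) (pr j == t).
Proof.
rewrite /hist input_end ?leq_addr //; apply: eq_bigr => j _.
by rewrite eqn_add2l eq_sym.
Qed.

Lemma count_ok (h : state) : (forall a, mem h a = input a) ->
  wpr count_prog h (3 + (3 + (3 + wcost n (Var 0 < eN) count_body))) (fun h' =>
    [/\ regs h' 1 = maxp, regs h' 2 = total & forall a, mem h' a = hist n a]).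
Proof.
move=> memE.
have B0 : 0 < B by rewrite expn_gt0.
apply: (wp_seq (T1 := 3)); apply: (wp_assign beta_gt0) => //.
apply: (wp_seq (T1 := 3)); apply: (wp_assign beta_gt0) => //.
apply: (wp_seq (T1 := 3)); apply: (wp_assign beta_gt0) => //.
apply: (wp_while beta_gt0 (Inv := fun k h' =>
  [/\ regs h' 0 = k, regs h' 1 = \max_(j < k) pr j,
      regs h' 2 = \sum_(j < k) pr j & forall a, mem h' a = hist k a])).
- move=> k h' kn [r0 r1 r2 me].
  have n0 : mem h' 0 = n by rewrite me hist_n.
  rewrite /= eval_eN0 // r0 kn; split=> // _.
  have pk : pr k <= total by apply: leq_trans (leq_sum_term pr kn) _.
  have job : mem h' k.+1 = pr k by rewrite me hist_pr.
  have histS a : hist k.+1 a = hist k a + (a == hbase + pr k).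
    by rewrite /hist big_ord_recr /= addnA.
  have addr : eval h' (eHB + eJob)%X = hbase + pr k.
    by rewrite /= eval_eHB0 // r0 addn1 job.
  have val : eval h' (Fetch (eHB + eJob) + Num 1)%X = hist k (hbase + pr k) + 1.
    by rewrite -me -addr.
  apply: wp_seqc; apply: (wp_store beta_gt0); rewrite ?addr val.
    apply: leq_ltn_trans n_lt; rewrite addn1 hist_hbase ltnS.
    apply: leq_trans (ltnW kn); rewrite -[X in _ <= X]card_ord -sum1_card.
    by apply: leq_sum => j _; case: eqP.
  set h1 := set_mem _ _ _.
  have me1 a : mem h1 a = hist k.+1 a.
    by rewrite histS /h1 /= /upd; case: eqP => [->|_]; rewrite ?addn0 ?me.
  have {r0} r0 : regs h1 0 = k by [].
  have {r1} r1 : regs h1 1 = \max_(j < k) pr j by [].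
  have {r2} r2 : regs h1 2 = \sum_(j < k) pr j by [].
  move: h1 me1 r0 r1 r2 => h1 {me job n0}me r0 r1 r2.
  have job : mem h1 k.+1 = pr k by rewrite me hist_pr.
  have sum_le : \sum_(j < k) pr j + pr k <= total.
    have -> : \sum_(j < k) pr j + pr k = \sum_(j < k.+1) pr j by rewrite big_ord_recr.
    by rewrite /total (big_ord_widen n pr kn) [X in X <= _]big_mkcond leq_sum // => j _; case: ifP.
  have max_le : \max_(j < k.+1) pr j <= total.
    apply: leq_trans maxp_le_total; apply/bigmax_leqP => j _.
    by apply: pr_le; apply: leq_trans (ltn_ord j) kn.
  apply: wp_seqc; apply: (wp_assign beta_gt0); rewrite /= r0 r2 addn1 job.
    exact: leq_ltn_trans sum_le total_lt.
  apply: wp_seqc; apply: (wp_assign beta_gt0); rewrite /= /upd /= r0 r1 addn1 job -maxnE maxnC.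
    have -> : maxn (\max_(j < k) pr j) (pr k) = \max_(j < k.+1) pr j by rewrite big_ord_recr.
    by apply: leq_ltn_trans max_le total_lt.
  apply: (wp_assign beta_gt0); rewrite /= /upd /= r0 addn1.
    exact: leq_ltn_trans (leqW kn) n_lt.
  by split; rewrite //= big_ord_recr.
- move=> h' _ [r0 r1 r2 me]; have n0 : mem h' 0 = n by rewrite me hist_n.
  by rewrite /= eval_eN0 // r0 ltnn.
- by split; rewrite ?big_ord0 // => a; rewrite memE /hist big_ord0 addn0.
Qed.

Lemma hist_high (a : nat) : pbase <= a -> hist n a = 0.
Proof.
move=> pa; rewrite /hist input_end; last by rewrite /pbase in pa; lia.
rewrite big1 // => j _; case: eqP => // E.
by have := pr_le pr (ltn_ord j); rewrite /pbase in pa; lia.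
Qed.

Definition jobs (h : state) : Prop := forall j, j < n -> mem h j.+1 = pr j.

Definition pows (k : nat) (a : nat) : nat :=
  if pbase <= a <= pbase + k then 2 ^ (a - pbase) else hist n a.

Lemma pow_ok (h : state) :
  regs h 1 = maxp -> regs h 2 = total -> (forall a, mem h a = hist n a) ->
  wpr pow_prog h (3 + (scost (SStore (ePB + Num 0) (Num 1))
                       + wcost levels (ePw (Var 3) < eN + Num 1) pow_body))
    (fun h' => [/\ static h', jobs h' & forall a, tbase <= a -> mem h' a = 0]).
Proof.
move=> p1 s2 me.
have B1 : 1 < B by apply: leq_ltn_trans n_lt; lia.
have pows0 k : pows k 0 = n by rewrite /pows hist_n ifN // /pbase /hbase; lia.
apply: wp_seq; apply: (wp_assign beta_gt0); first exact: ltnW.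
apply: wp_seq; apply: (wp_store beta_gt0) => //.
have addr : eval (set_reg h 3 (eval h (Num 0))) (ePB + Num 0)%X = pbase.
  by rewrite [LHS]/= eval_ePB0 ?addn0 //= me hist_n.
rewrite addr; apply: (wp_while beta_gt0 (Inv := fun k h' =>
  [/\ regs h' 1 = maxp, regs h' 2 = total, regs h' 3 = k
    & forall a, mem h' a = pows k a])).
- move=> k h' kL [{p1}p1 {s2}s2 r3 {me}me]; have n0 : mem h' 0 = n by rewrite me.
  have pw : eval h' (ePw (Var 3)) = 2 ^ k.
    by rewrite eval_ePw0 //= r3 me /pows leq_addr leqnn addKn.
  have kn : 2 ^ k <= n by apply: leq_trans (trunc_logP (isT : 1 < 2) n_gt0); rewrite leq_exp2l.
  rewrite /= pw eval_eN0 // addn1 ltnS kn; split=> // _.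
  have addr1 : eval h' (ePB + (Var 3 + Num 1))%X = pbase + k.+1.
    by rewrite [LHS]/= eval_ePB0 // r3 addn1.
  have val : eval h' (Num 2 * ePw (Var 3))%X = 2 ^ k.+1.
    by rewrite [LHS]/= pw expnS.
  apply: wp_seqc; apply: (wp_store beta_gt0); rewrite val ?addr1.
    by apply: leq_ltn_trans levels_lt; rewrite leq_exp2l.
  apply: (wp_assign beta_gt0); rewrite /= r3 addn1.
    by apply: ltn_trans (ltn_expl k.+1 (isT : 1 < 2)) _;
       apply: leq_ltn_trans levels_lt; rewrite leq_exp2l.
  split=> // a; rewrite /= /upd /pows; case: eqP => [->|ne].
    by rewrite leq_addr leqnn addKn.
  rewrite me /pows; have -> // : (a <= pbase + k.+1) = (a <= pbase + k).
  by rewrite addnS leq_eqVlt ltnS; case: eqP => // E; case: ne; rewrite addnS.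
- move=> h' _ [{p1}p1 {s2}s2 r3 {me}me]; have n0 : mem h' 0 = n by rewrite me.
  have pw : eval h' (ePw (Var 3)) = 2 ^ levels.
    by rewrite eval_ePw0 //= r3 me /pows leq_addr leqnn addKn.
  rewrite /= pw eval_eN0 // addn1 ltnS leqNgt n_lt_levels; split=> //.
  have low_mem a : a < pbase -> mem h' a = hist n a.
    by move=> ap; rewrite me /pows leqNgt ap.
  split.
  + split=> //; split.
    * by move=> i im; rewrite low_mem ?hist_low ?input_num // /pbase /hbase; lia.
    * by move=> i im; rewrite low_mem ?hist_low ?input_den // /pbase /hbase; lia.
    * by move=> t tp; rewrite low_mem ?hist_hbase // /pbase; lia.
    * by move=> l lL; rewrite me /pows leq_addr leq_add2l lL addKn.
  + by move=> j jn; rewrite low_mem ?hist_pr // /pbase /hbase; lia.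
  + move=> a ta; rewrite me /pows ifN ?hist_high //; first by rewrite /tbase in ta; lia.
    by rewrite /tbase in ta; lia.
- split=> // a; rewrite /= /upd /pows addn0 -eqn_leq eq_sym; case: eqP => [->|_]; last exact: me.
  by rewrite subnn.
Qed.

Lemma static_mem (h : state) (a v : nat) :
  static h -> tbase <= a -> static (set_mem h a v).
Proof.
have lt_tb b : b < tbase -> tbase <= a -> upd (mem h) a v b = mem h b.
  by move=> bt ta; rewrite upd_neq //; lia.
case=> n0 p1 s2 l3 [numE denE histE powE] ta; split=> //=.
  by rewrite lt_tb // /tbase /pbase /hbase; lia.
split.
- by move=> i im; rewrite lt_tb ?numE // /tbase /pbase /hbase; lia.
- by move=> i im; rewrite lt_tb ?denE // /tbase /pbase /hbase; lia.
- by move=> t tp; rewrite lt_tb ?histE // /tbase /pbase; lia.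
- by move=> l lL; rewrite lt_tb ?powE // /tbase; lia.
Qed.

Lemma static_reg (h : state) (x v : nat) :
  static h -> x \notin [:: 1; 2; 3] -> static (set_reg h x v).
Proof.
case=> n0 p1 s2 l3 M; rewrite !inE !negb_or => /and3P[x1 x2 x3].
by split=> //=; rewrite upd_neq // eq_sym.
Qed.

Lemma jobs_mem (h : state) (a v : nat) : jobs h -> tbase <= a -> jobs (set_mem h a v).
Proof.
move=> jb ta j jn /=; rewrite upd_neq ?jb //.
by move: ta; rewrite /tbase /pbase /hbase; lia.
Qed.

Definition tab (h : state) (q e : nat) : nat := mem h (tbase + (q * width ^ m + e)).

Definition top (h : state) : Prop :=
  forall e, e < width ^ m -> tab h nslots e = (e == 0).

(* An entry encodes the machine and the state it was reached from. *)
Definition sound (h : state) : Prop :=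
  forall q e, q < nslots -> e < width ^ m -> tab h q e != 0 ->
  let v := (tab h q e).-1 in
  [/\ v %/ m < width ^ m, tab h q.+1 (v %/ m) != 0,
      valid q (v %% m) (v %/ m) != 0 & succ q (v %% m) (v %/ m) = e].

(** Transitions are numbered by the loop counter, and those numbered from [z] on have been applied.
    For [z = 0] this is the closure that [walk_reach] asks for. *)
Definition closed (z : nat) (h : state) : Prop :=
  forall q j e, q < nslots -> j < m -> e < width ^ m ->
  z <= (q * width ^ m + e) * m + j ->
  tab h q.+1 e != 0 -> valid q j e != 0 -> tab h q (succ q j e) != 0.

Definition table (z : nat) (h : state) : Prop :=
  [/\ static h, jobs h, top h, sound h & closed z h /\ forall a, xbase <= a -> mem h a = 0].

Lemma table_reg (z : nat) (h : state) (x v : nat) :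
  table z h -> x \notin [:: 1; 2; 3] -> table z (set_reg h x v).
Proof. by case=> st *; split=> //; exact: static_reg. Qed.

Lemma tab_upd (h : state) (q e v q1 e1 : nat) :
  e < width ^ m -> e1 < width ^ m ->
  tab (set_mem h (tbase + (q * width ^ m + e)) v) q1 e1 =
  if (q1 == q) && (e1 == e) then v else tab h q1 e1.
Proof.
move=> eW e1W; rewrite /tab /= /upd eqn_add2l; congr (if _ then _ else _).
apply/eqP/andP => [E|[/eqP-> /eqP-> //]].
have Wm0 : 0 < width ^ m by exact: leq_ltn_trans eW.
split; apply/eqP.
  have := congr1 (divn^~ (width ^ m)) E.
  by rewrite !divnMDl // !divn_small // !addn0.
by have := congr1 (modn^~ (width ^ m)) E; rewrite !modnMDl !modn_small.
Qed.

Lemma valid_succ_lt (q j e : nat) : valid q j e != 0 -> succ q j e < width ^ m.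
Proof. by move=> /validP win; case: (valid_succ m_gt0 win). Qed.

Lemma cell_decode (q j e : nat) : j < m -> e < width ^ m ->
  let z := (q * width ^ m + e) * m + j in
  [/\ z %% m = j, z %/ m %% width ^ m = e & z %/ m %/ width ^ m = q].
Proof.
move=> jm eW /=; rewrite modnMDl modn_small // divnMDl // divn_small // addn0.
by rewrite modnMDl modn_small // divnMDl ?divn_small ?addn0 //; exact: leq_ltn_trans eW.
Qed.

Lemma closed_skip (h : state) (q j e : nat) : j < m -> e < width ^ m ->
  let z := (q * width ^ m + e) * m + j in
  closed z.+1 h -> (tab h q.+1 e = 0 \/ valid q j e = 0) -> closed z h.
Proof.
move=> jm eW z cl none q' j' e' qn' jm' eW'.
rewrite leq_eqVlt => /predU1P[E t1 v1|]; last exact: cl.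
have [dj de dq] := cell_decode q jm eW; have [dj' de' dq'] := cell_decode q' jm' eW'.
have jE : j' = j by rewrite -dj' -E.
have eE : e' = e by rewrite -de' -E.
have qE : q' = q by rewrite -dq' -E.
by move: t1 v1; rewrite jE eE qE => /eqP t1 /eqP v1; case: none.
Qed.

(** The store changes row [q] only, while the transitions applied so far start in rows above [q]; so
    none of them gets a new source. Overwriting a nonzero entry is harmless, because each entry is
    justified by its own predecessor. *)
Lemma table_store (h : state) (q j e : nat) :
  q < nslots -> j < m -> e < width ^ m ->
  let z := (q * width ^ m + e) * m + j in
  table z.+1 h -> tab h q.+1 e != 0 -> valid q j e != 0 ->
  table z (set_mem h (tbase + (q * width ^ m + succ q j e)) (e * m + j).+1).
Proof.
move=> qn jm eW z [sth jb tp sd [cl xz]] t1 v1.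
have sW := valid_succ_lt v1; set h' := set_mem _ _ _.
have tabE q1 e1 : e1 < width ^ m -> tab h' q1 e1 =
    if (q1 == q) && (e1 == succ q j e) then (e * m + j).+1 else tab h q1 e1.
  exact: tab_upd.
have mono q1 e1 : e1 < width ^ m -> tab h q1 e1 != 0 -> tab h' q1 e1 != 0.
  by move=> e1W; rewrite tabE //; case: ifP.
split.
- by apply: static_mem => //; lia.
- by apply: jobs_mem => //; lia.
- by move=> e1 e1W; rewrite tabE // (gtn_eqF qn) tp.
- move=> q1 e1 q1n e1W; rewrite tabE //; case: ifP => [/andP[/eqP-> /eqP->] _|_] /=.
    rewrite modnMDl modn_small // divnMDl // divn_small // addn0.
    by split=> //; exact: mono.
  by move=> /(sd q1 e1 q1n e1W)[]; split=> //; exact: mono.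
- split=> [|a xa]; last first.
    rewrite /= upd_neq ?xz //; move: xa; rewrite /xbase.
    by have := leq_mul qn (leqnn (width ^ m)); lia.
  move=> q1 j1 e1 q1n j1m e1W le1 t2 v2; have s1W := valid_succ_lt v2.
  rewrite tabE //; case: ifP => //= ne.
  have le_q : q <= q1.
    have [_ _ <-] := cell_decode q jm eW; have [_ _ <-] := cell_decode q1 j1m e1W.
    by rewrite !leq_div2r.
  move: t2; rewrite tabE // (gtn_eqF (le_q : q < q1.+1)) /= => t2.
  move: le1; rewrite leq_eqVlt => /predU1P[E|]; last by move=> lt1; exact: cl.
  have [dj de dq] := cell_decode q jm eW; have [dj' de' dq'] := cell_decode q1 j1m e1W.
  have jE : j1 = j by rewrite -dj' -E.
  have eE : e1 = e by rewrite -de' -E.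
  have qE : q1 = q by rewrite -dq' -E.
  by move: ne; rewrite jE eE qE !eqxx.
Qed.

Definition ncells : nat := nslots * width ^ m * m.

Lemma dp_ok (h : state) :
  static h -> jobs h -> (forall a, tbase <= a -> mem h a = 0) ->
  wpr dp_prog h (scost (SStore (eTab eQ (Num 0)) (Num 1))
                 + (scost (SAssign 0 (eQ * eWm * Num m)) + wcost ncells (Var 0) dp_body))
    (table 0).
Proof.
move=> sth jb zero.
have Wm0 : 0 < width ^ m by rewrite expn_gt0 width_gt0.
have B1 : 1 < B by apply: leq_ltn_trans n_lt; lia.
have ncells_lt : ncells < B by apply: leq_ltn_trans table_lt; rewrite /ncells; lia.
apply: wp_seq; apply: (wp_store beta_gt0) => //.
rewrite eval_eTab // eval_eQ //=.
have addr : tbase <= tbase + (nslots * width ^ m + 0) by lia.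
have := static_mem 1 sth addr; have := jobs_mem 1 jb addr.
have tab1 q e : e < width ^ m ->
    tab (set_mem h (tbase + (nslots * width ^ m + 0)) 1) q e = ((q == nslots) && (e == 0)).
  by move=> eW; rewrite tab_upd //; case: ifP => // _; rewrite /tab zero //; lia.
have xz a : xbase <= a -> mem (set_mem h (tbase + (nslots * width ^ m + 0)) 1) a = 0.
  rewrite /xbase => xa; rewrite /= upd_neq ?zero //; first lia.
  by rewrite mulnDl mul1n in xa; lia.
move: xz tab1; move: (set_mem _ _ _) => {h sth jb zero addr} h xz tab1 jb sth.
(* Below the top row all entries are 0, so soundness is vacuous; closure is too, as every transition
   has a number below [ncells]. *)
have init : table ncells h.
  split=> //.
  - by move=> e eW; rewrite tab1 // eqxx.
  - by move=> q e qn eW; rewrite tab1 // (ltn_eqF qn).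
  - split=> // q j e qn jm eW le.
    suff : (q * width ^ m + e) * m + j < ncells by rewrite ltnNge le.
    by rewrite /ncells; nia.
have zE : eval h (eQ * eWm * Num m)%X = ncells by rewrite /= eval_eQ // eval_eWm.
apply: wp_seq; apply: (wp_assign beta_gt0); rewrite zE //.
apply: (wp_while beta_gt0 (Inv := fun k h' =>
  regs h' 0 = ncells - k /\ table (ncells - k) h')).
- move=> k {sth jb tab1 xz init zE}h kN [r0 tb].
  rewrite /= r0 -lt0n subn_gt0 kN; split=> // _.
  have [z zE] : exists z, ncells - k = z.+1 by exists (ncells - k).-1; lia.
  have zN : z < ncells by lia.
  rewrite zE in r0 tb; have -> : ncells - k.+1 = z by lia.
  apply: wp_seqc; apply: (wp_assign beta_gt0); rewrite /= r0 subn1 /=.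
    exact: ltn_trans zN ncells_lt.
  have {tb} : table z.+1 (set_reg h 0 z) by exact: table_reg.
  have {r0} : regs (set_reg h 0 z) 0 = z by [].
  move: (set_reg _ _ _) => {}h r0 tb; have [sth _ _ _ _] := tb.
  have ej : eval h eZj = z %% m by rewrite /= r0.
  have ee : eval h eZe = z %/ m %% width ^ m by rewrite /= r0 eval_eWm.
  have eq : eval h eZq = z %/ m %/ width ^ m by rewrite /= r0 eval_eWm.
  set j := z %% m in ej; set e := _ %% _ in ee; set q := _ %/ _ in eq.
  have jm : j < m by rewrite ltn_pmod.
  have eW : e < width ^ m by rewrite ltn_pmod.
  have qn : q < nslots by rewrite /q !ltn_divLR.
  have zdef : z = (q * width ^ m + e) * m + j by rewrite /q /e -divn_eq /j -divn_eq.
  have cE : eval h ((Num 0 < Fetch (eTab (eZq + Num 1) eZe)) * eValid eZq eZj eZe)%X =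
            (tab h q.+1 e != 0) * valid q j e.
    rewrite -[LHS]/((0 < mem h (eval h (eTab (eZq + Num 1) eZe)))
                    * eval h (eValid eZq eZj eZe)).
    rewrite eval_eTab // eval_eValid ?eq // ej ee -[eval h (eZq + Num 1)%X]/(eval h eZq + 1).
    by rewrite eq addn1 lt0n.
  apply: (wp_ifc beta_gt0); rewrite cE; last first.
    rewrite zdef => c0; split; first by rewrite -zdef.
    case: tb => ? ? ? ?; rewrite {1}zdef => -[cl xz]; split=> //; split=> //.
    apply: closed_skip cl _ => //.
    by move: c0; case: eqP => [->|_]; [left | rewrite mul1n; right].
  rewrite muln_eq0 negb_or eqb0 negbK => /andP[t1 v1].
  have eW' : e * m + j < width ^ m * m by nia.
  have vE : eval h (Var 0 %% (eWm * Num m) + Num 1)%X = (e * m + j).+1.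
    rewrite /= r0 eval_eWm // addn1 zdef mulnDl -mulnA -addnA modnMDl modn_small //.
  apply: (wp_store beta_gt0); rewrite vE.
    by apply: leq_ltn_trans table_lt; lia.
  rewrite eval_eTab // eval_eSucc ?eq // ej ee; split=> //.
  by rewrite zdef in tb *; exact: table_store.
- by move=> h' _ [r0 tb]; rewrite subnn in r0 tb; rewrite /= r0.
- by rewrite subn0; split=> //; exact: table_reg.
Qed.

(** Every digit is below [width], and a window of row 0 starts no higher than the share, which is at
    most [total]. *)
Lemma cost_vec_lt (e : nat) : (cost (vec 0 e)).+1 < B.
Proof.
have B1 : 1 < B by apply: leq_ltn_trans n_lt; lia.
suff : cost (vec 0 e) <= B - 2 by lia.
apply/bigmax_leqP => i _; have im := ltn_ord i.
have := cost_lt im; suff : vec 0 e i * wgt i <= (width + total) * wgt i by lia.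
rewrite leq_mul2r leq_add ?orbT //; first by rewrite ltnW // ltn_pmod // width_gt0.
apply: leq_trans (leq_subr _ _) _; rewrite div0n divn1.
exact: (share_le n pr m_gt0 num_gt0 den_gt0 im).
Qed.

Definition best (h : state) (e : nat) : Prop :=
  [/\ e < width ^ m, tab h 0 e != 0 & forall e', e' < width ^ m ->
      tab h 0 e' != 0 -> cost (vec 0 e) <= cost (vec 0 e')].

Lemma best_ok (h : state) :
  table 0 h -> (exists2 e, e < width ^ m & tab h 0 e != 0) ->
  wpr best_prog h (3 + (3 + wcost (width ^ m) (Var 0 < eWm) best_body))
    (fun h' => table 0 h' /\ best h' (regs h' 5)).
Proof.
move=> tb [e1 e1W te1].
have B0 : 0 < B by rewrite expn_gt0.
have Wm_lt : width ^ m < B by apply: leq_ltn_trans table_lt; move: m_gt0; nia.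
apply: wp_seq; apply: (wp_assign beta_gt0) => //.
apply: wp_seq; apply: (wp_assign beta_gt0) => //=.
pose inv k h' := [/\ table 0 h', mem h' = mem h, regs h' 0 = k,
  regs h' 4 = 0 -> forall e, e < k -> tab h 0 e = 0
  & regs h' 4 != 0 -> [/\ regs h' 5 < width ^ m, tab h 0 (regs h' 5) != 0,
      regs h' 4 = (cost (vec 0 (regs h' 5))).+1
      & forall e, e < k -> tab h 0 e != 0 -> cost (vec 0 (regs h' 5)) <= cost (vec 0 e)]].
apply: (wp_while beta_gt0 (Inv := inv)).
- move=> k h' kW [{}tb mh r0 none some]; have [sth _ _ _ _] := tb.
  rewrite /= eval_eWm // r0 kW; split=> // _.
  have cE : eval h' (eCost (Var 0) + Num 1)%X = (cost (vec 0 k)).+1.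
    by rewrite -[LHS]/(eval h' (eCost (Var 0)) + 1) eval_eCost //= r0 addn1.
  have condE : eval h' ((Num 0 < Fetch (eTab (Num 0) (Var 0))) *
             ((Var 4 == Num 0) + (eCost (Var 0) + Num 1 < Var 4)))%X =
             (tab h 0 k != 0) * ((regs h' 4 == 0) + ((cost (vec 0 k)).+1 < regs h' 4)).
    rewrite -[LHS]/((0 < mem h' (eval h' (eTab (Num 0) (Var 0)))) * ((regs h' 4 == 0)
      + (eval h' (eCost (Var 0) + Num 1)%X < regs h' 4))).
    by rewrite cE eval_eTab //= r0 mh lt0n.
  (* The increment is common to both outcomes of the test; it only requires that state [k], if
     reachable, is no better than the current candidate. *)
  have next_inv h1 : inv k h1 -> (tab h 0 k != 0 -> regs h1 4 != 0 /\
      cost (vec 0 (regs h1 5)) <= cost (vec 0 k)) -> wpr incr h1 (scost incr) (inv k.+1).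
    move=> [tb1 mh1 r01 none1 some1] ck; apply: (wp_assign beta_gt0); rewrite /= r01 addn1.
      exact: leq_ltn_trans kW Wm_lt.
    split=> //=.
    + rewrite /upd /= => r4 e; rewrite ltnS leq_eqVlt => /predU1P[->|]; last exact: none1.
      by apply/eqP/negPn/negP => /ck[]; rewrite r4.
    + rewrite /upd /= => r4; have [r5 t5 c5 b5] := some1 r4; split=> // e.
      rewrite ltnS leq_eqVlt => /predU1P[->|]; last exact: b5.
      by case/ck.
  apply: wp_seqc; apply: (wp_ifc beta_gt0); rewrite condE.
    rewrite muln_eq0 negb_or eqb0 negbK addn_eq0 negb_and !eqb0 !negbK => /andP[tk lt].
    apply: wp_seqc; apply: (wp_assign beta_gt0); rewrite cE; first exact: cost_vec_lt.
    apply: (wp_assign beta_gt0); rewrite /= /upd /= r0; first exact: ltn_trans kW Wm_lt.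
    apply: next_inv => //; split=> //.
    + move=> _ /=; split=> // e ek te; rewrite /upd /=.
      case/orP: lt => [/eqP r4|lt]; first by rewrite (none r4) ?eqxx in te.
      have [|_ _ r4 b4] := some; first by rewrite -lt0n; apply: leq_ltn_trans lt.
      by apply: ltnW; apply: leq_trans (b4 e ek te); rewrite r4 !ltnS in lt; exact: lt.
  move=> c0; apply: next_inv => // tk; move: c0; rewrite tk mul1n.
  have [r4|r4] := eqVneq (regs h' 4) 0 => //=.
  have [_ _ rc _] := some r4.
  by rewrite rc ltnS; case: leqP => // le _; split.
- move=> h' _ [{}tb mh r0 none some]; have [sth _ _ _ _] := tb.
  rewrite /= eval_eWm // r0 ltnn; split=> //; split=> //.
  have r4 : regs h' 4 != 0 by apply: contraNneq te1 => /none -> .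
  have [r5 t5 _ b5] := some r4.
  by split=> //; rewrite /tab mh.
- by split=> //; do 2 apply: table_reg.
Qed.

Definition xcell (h : state) (t i : nat) : nat := mem h (xbase + (t * m + i)).

Lemma xcell_upd (h : state) (t i v t1 i1 : nat) : i < m -> i1 < m ->
  xcell (set_mem h (xbase + (t * m + i)) v) t1 i1 =
  if (t1 == t) && (i1 == i) then v else xcell h t1 i1.
Proof.
move=> im i1m; rewrite /xcell /= /upd eqn_add2l; congr (if _ then _ else _).
apply/eqP/andP => [E|[/eqP-> /eqP-> //]]; split; apply/eqP.
  by have := congr1 (divn^~ m) E; rewrite !divnMDl // !divn_small // !addn0.
by have := congr1 (modn^~ m) E; rewrite !modnMDl !modn_small.
Qed.

Lemma tab_high (h : state) (a v q e : nat) :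
  q <= nslots -> e < width ^ m -> xbase <= a -> tab (set_mem h a v) q e = tab h q e.
Proof.
move=> qn eW xa; rewrite /tab /= upd_neq //; move: xa; rewrite /xbase.
by have := leq_mul qn (leqnn (width ^ m)); lia.
Qed.

Local Notation slot_count := (slot_count m n pr).

(** A conservation law: each active slot of level [l] moves [2 ^ l] jobs from the current state to
    the cells of their machine, and [V] stays the sum of both. The cells lie beyond the table, which
    therefore remains readable. *)
Definition tracing (V : nat -> nat) (k : nat) (h : state) : Prop :=
  [/\ static h, jobs h, top h /\ sound h, regs h 0 = k &
  [/\ regs h 5 < width ^ m, tab h k (regs h 5) != 0,
      forall i, i < m -> V i = 2 ^ (k %/ lsize) * vec k (regs h 5) i
                               + \sum_(t < maxp.+1) t * xcell h t i
    & forall t, t <= maxp -> \sum_(i < m) xcell h t i = \sum_(q < k) slot_count q t]].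

Lemma sum_slot_count_le (k t : nat) : k <= nslots -> t <= maxp ->
  \sum_(q < k) slot_count q t <= n.
Proof.
move=> kn tp; apply: leq_trans (cnt_le n pr t).
rewrite -(sum_slot_count m_gt0 tp) (big_ord_widen nslots (slot_count^~ t) kn).
by rewrite [X in X <= _]big_mkcond leq_sum // => q _; case: ifP.
Qed.

Lemma back_ok (h : state) : table 0 h -> best h (regs h 5) ->
  wpr back_prog h (3 + wcost nslots (Var 0 < eQ) back_body)
    (fun h' => [/\ static h', jobs h',
       forall i, i < m -> vec 0 (regs h 5) i = \sum_(t < maxp.+1) t * xcell h' t i
     & forall t, t <= maxp -> \sum_(i < m) xcell h' t i = cnt t]).
Proof.
set V := vec 0 (regs h 5); move=> [sth jb tp sd [_ xz]] [r5 t5 _].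
have B0 : 0 < B by rewrite expn_gt0.
have Wm0 : 0 < width ^ m by rewrite expn_gt0 width_gt0.
have cell_le : width ^ m * m < B by apply: leq_ltn_trans table_lt; lia.
have nslots_lt : nslots < B.
  by apply: leq_ltn_trans table_lt; move: m_gt0 Wm0; move: (width ^ m) => X; nia.
apply: wp_seq; apply: (wp_assign beta_gt0) => //=.
apply: (wp_while beta_gt0 (Inv := tracing V)).
- move=> k h' kn [{}sth {}jb [{}tp {}sd] r0 [{}r5 {}t5 VE XE]].
  rewrite /= eval_eQ // r0 kn; split=> // _.
  set e := regs h' 5 in r5 t5 VE.
  have [e0W te0 v1 sE] := sd k e kn r5 t5.
  set v := (tab h' k e).-1 in e0W te0 v1 sE.
  set e0 := v %/ m in e0W te0 v1 sE; set j := v %% m in v1 sE.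
  have jm : j < m by rewrite ltn_pmod.
  have vecE i : i < m -> vec k e i = next k j e0 i.
    by move=> im; rewrite -sE; have [_ _ ->] := valid_succ m_gt0 (validP v1).
  have v_lt : v < width ^ m * m by rewrite -ltn_divLR.
  have val4 : eval h' (Fetch (eTab (Var 0) (Var 5)) - Num 1)%X = v.
    rewrite -[LHS]/(mem h' (eval h' (eTab (Var 0) (Var 5))) - 1) eval_eTab //=.
    by rewrite r0 subn1.
  apply: wp_seqc; apply: (wp_assign beta_gt0); rewrite val4; first exact: ltn_trans v_lt cell_le.
  set h1 := set_reg h' 4 v.
  have st1 : static h1 by exact: static_reg.
  have addr : eval h1 eSlotX = xbase + (typ k * m + j).
    by rewrite eval_eX // eval_eTyp //= /upd /= r0.
  set t := typ k in addr; have tP : t <= maxp by rewrite -ltnS ltn_pmod.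
  have val : eval h1 (Fetch eSlotX + eAct (Var 0) * ePw (Var 0 / eLs))%X =
      xcell h' t j + act k * 2 ^ (k %/ lsize).
    rewrite -[LHS]/(mem h' (eval h1 eSlotX) + eval h1 (eAct (Var 0)) * eval h1 (ePw (Var 0 / eLs))).
    rewrite addr eval_eAct //= /upd /= r0 // eval_ePw //= /upd /= r0 eval_eLs //.
    by rewrite -(mulnK levels (lsize_gt0 n pr m_gt0)) leq_div2r // ltnW.
  set c := act k * 2 ^ (k %/ lsize) in val.
  have cE t1 : (t1 == t) * c = slot_count k t1 by rewrite /slot_count eq_sym.
  have XE1 : \sum_(i < m) xcell h' t i + c = \sum_(q < k.+1) slot_count q t.
    by rewrite big_ord_recr /= XE // -cE eqxx mul1n.
  apply: wp_seqc; apply: (wp_store beta_gt0); rewrite val ?addr.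
    apply: leq_ltn_trans (ltnW n_lt); apply: leq_trans (sum_slot_count_le kn tP).
    by rewrite -XE1 leq_add2r; exact: (leq_sum_term (xcell h' t) jm).
  set h2 := set_mem h1 _ _.
  have x_le : xbase <= xbase + (t * m + j) by exact: leq_addr.
  have tb_le : tbase <= xbase + (t * m + j) by rewrite (leq_trans _ x_le) ?leq_addr.
  have st2 : static h2 by exact: static_mem.
  have jb2 : jobs h2 by exact: jobs_mem.
  have tabE q e' : q <= nslots -> e' < width ^ m -> tab h2 q e' = tab h' q e'.
    by move=> qn e'W; rewrite tab_high.
  have xE t1 i1 : i1 < m ->
      xcell h2 t1 i1 = xcell h' t1 i1 + (t1 == t) * ((i1 == j) * c).
    move=> i1m; rewrite xcell_upd //; case: eqP => [->|_]; last by rewrite addn0.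
    by case: eqP => [->|_] /=; rewrite ?mul1n ?mul0n ?muln0 ?addn0.
  have tp2 : top h2 by move=> e' e'W; rewrite tabE // tp.
  have sd2 : sound h2.
    move=> q e' qn e'W; rewrite tabE //; last exact: ltnW.
    by move=> /(sd q e' qn e'W) [a1 a2 a3 a4]; split=> //; rewrite tabE.
  have r02 : regs h2 0 = k by [].
  have r42 : regs h2 4 = v by [].
  move: h2 st2 jb2 tabE xE tp2 sd2 r02 r42 => h2 st2 jb2 tabE xE tp2 sd2 r02 r42.
  apply: wp_seqc; apply: (wp_assign beta_gt0); rewrite /= r42.
    apply: leq_ltn_trans (ltn_trans v_lt cell_le); exact: leq_div.
  have fin : tracing V k.+1 (set_reg (set_reg h2 5 e0) 0 k.+1).
    split=> //; split=> //.
    + by change (tab h2 k.+1 e0 != 0); rewrite tabE.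
    + move=> i im; change (V i = 2 ^ (k.+1 %/ lsize) * vec k.+1 e0 i
                          + \sum_(t1 < maxp.+1) t1 * xcell h2 t1 i).
      rewrite VE // vecE // pow_dbl // /next.
      under [X in _ = _ + X]eq_bigr do rewrite xE // mulnDr.
      rewrite big_split /= addnCA addnA.
      have -> : \sum_(t1 < maxp.+1) t1 * ((t1 == t :> nat) * ((i == j) * c)) = t * ((i == j) * c).
        rewrite -(sum_delta (fun t1 => t1 * ((i == j) * c)) (tP : t < maxp.+1)).
        by apply: eq_bigr => t1 _; rewrite mulnCA.
      by rewrite /psize -/t /c; lia.
    + move=> t1 t1P; change (\sum_(i < m) xcell h2 t1 i = \sum_(q < k.+1) slot_count q t1).
      rewrite big_ord_recr /= -XE // -cE.
      rewrite (eq_bigr (fun i : 'I_m => xcell h' t1 i + (t1 == t) * ((i == j :> nat) * c))).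
        by rewrite big_split /= -big_distrr /= (sum_delta (fun=> c) jm).
      by move=> i _; rewrite xE.
  apply: (wp_assign beta_gt0); rewrite /= /upd /= r02 addn1; last exact: fin.
  exact: leq_ltn_trans kn nslots_lt.
- move=> h' _ [{}sth {}jb [{}tp {}sd] r0 [{}r5 {}t5 VE XE]].
  rewrite /= eval_eQ // r0 ltnn; split=> //; split=> //.
    (* The only reachable state of the top row is code 0, whose vector is zero, so the cells account
       for all of [V]. *)
    move=> i im; rewrite VE //; move: t5; rewrite tp // eqb0 negbK => /eqP ->.
    by rewrite vec_nslots // muln0.
  by move=> t tP; rewrite XE // sum_slot_count.
- have x0 t i : xcell (set_reg h 0 0) t i = 0 by rewrite /xcell xz ?leq_addr.
  split=> //; split=> //.
  + move=> i im; rewrite div0n mul1n big1 ?addn0 // => t _.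
    by rewrite x0 muln0.
  + by move=> t _; rewrite big_ord0 big1 // => i _; rewrite x0.
Qed.

Lemma eval_eFind (h : state) (t : expr) (k : nat) : static h ->
  let f := eval h (eFind t k) in
  \sum_(i < k) xcell h (eval h t) i != 0 -> f < k /\ xcell h (eval h t) f != 0.
Proof.
move=> st; elim: k => [|k ih]; first by rewrite big_ord0.
rewrite big_ord_recr /= eval_eX //= -/(xcell h (eval h t) k).
set f := eval h (eFind t k) in ih *.
have [x0|x0] := eqVneq (xcell h (eval h t) k) 0.
  rewrite x0 addn0 muln1 muln0 addn0 => /ih[fk fx].
  by split=> //; exact: ltnW.
by rewrite muln0 add0n lt0n x0 muln1.
Qed.

(** The output replaces job sizes only: [n] is in cell 0, and all other memory that [static]
    mentions lies beyond cell [n]. *)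
Lemma static_job (h : state) (j v : nat) : j < n -> static h -> static (set_mem h j.+1 v).
Proof.
move=> jn; have out b : n < b -> upd (mem h) j.+1 v b = mem h b.
  by move=> nb; rewrite upd_neq //; lia.
case=> n0 p1 s2 l3 [numE denE histE powE]; split=> //; split.
- by move=> i im; rewrite [LHS]out ?numE //; lia.
- by move=> i im; rewrite [LHS]out ?denE //; lia.
- by move=> t tp; rewrite [LHS]out ?histE // /hbase; lia.
- by move=> l lL; rewrite [LHS]out ?powE // /pbase /hbase; lia.
Qed.

(** The first sum guarantees that [eFind] succeeds for job [k]; the second shows, once the cells are
    exhausted, that the placement realizes the counts [x]. *)
Definition placing (x : nat -> nat -> nat) (k : nat) (h : state) : Prop :=
  [/\ static h, regs h 0 = k, forall j, k <= j -> j < n -> mem h j.+1 = pr j,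
      forall j, j < k -> mem h j.+1 < m &
  (forall t, t <= maxp ->
     \sum_(i < m) xcell h t i = \sum_(j < n) (k <= j) * (pr j == t)) /\
  (forall t i, t <= maxp -> i < m ->
     xcell h t i + \sum_(j < k) (pr j == t) * (mem h j.+1 == i) = x t i)].

Lemma assign_ok (h : state) (V : nat -> nat) :
  static h -> jobs h ->
  (forall i, i < m -> V i = \sum_(t < maxp.+1) t * xcell h t i) ->
  (forall t, t <= maxp -> \sum_(i < m) xcell h t i = cnt t) ->
  wpr assign_prog h (3 + wcost n (Var 0 < eN) assign_body)
    (fun h' => (forall j, j < n -> mem h' j.+1 < m) /\
       forall i, i < m -> mload n pr (fun j => mem h' j.+1) i = V i).
Proof.
move=> sth jb VE XE.
have B0 : 0 < B by rewrite expn_gt0.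
have nB : n < B by exact: ltnW.
have m_lt : m < B.
  apply: leq_ltn_trans table_lt; have : 0 < width ^ m by rewrite expn_gt0 width_gt0.
  by move: (width ^ m) => X; nia.
pose x := xcell h.
apply: wp_seq; apply: (wp_assign beta_gt0) => //=.
apply: (wp_while beta_gt0 (Inv := placing x)).
- move=> k h' kn [{}sth r0 {}jb small [{}XE xE]].
  rewrite /= eval_eN // r0 kn; split=> // _.
  have job : eval h' eJob = pr k by rewrite /= r0 addn1 jb.
  have tP : pr k <= maxp by exact: pr_le.
  have Xk : \sum_(i < m) xcell h' (pr k) i != 0.
    rewrite XE // -lt0n.
    have := leq_sum_term (fun j => (k <= j) * (pr j == pr k)) kn.
    by rewrite leqnn eqxx.
  have [] := eval_eFind (t := eJob) (k := m) sth; rewrite job // => fm fx.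
  set f := eval h' (eFind eJob m) in fm fx.
  apply: wp_seqc; apply: (wp_assign beta_gt0); rewrite -/f; first exact: ltn_trans fm m_lt.
  set h1 := set_reg h' 4 f.
  have st1 : static h1 by exact: static_reg.
  have addr : eval h1 (eX eJob (Var 4)) = xbase + (pr k * m + f).
    by rewrite eval_eX //= /upd /= r0 addn1 jb.
  have val : eval h1 (Fetch (eX eJob (Var 4)) - Num 1)%X = xcell h' (pr k) f - 1.
    by rewrite -[LHS]/(mem h' (eval h1 (eX eJob (Var 4))) - 1) addr.
  have x_lt : xcell h' (pr k) f <= n.
    apply: leq_trans (leq_sum_term (xcell h' (pr k)) fm) _; rewrite XE //.
    rewrite -[X in _ <= X]card_ord -sum1_card; apply: leq_sum => j _.
    by case: (k <= j); case: (pr j == pr k).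
  apply: wp_seqc; apply: (wp_store beta_gt0); rewrite val ?addr.
    by apply: leq_ltn_trans nB; apply: leq_trans x_lt; exact: leq_subr.
  set h2 := set_mem h1 _ _.
  have x_le : xbase <= xbase + (pr k * m + f) by exact: leq_addr.
  have tb_le : tbase <= xbase + (pr k * m + f) by rewrite (leq_trans _ x_le) ?leq_addr.
  have st2 : static h2 by exact: static_mem.
  have xE2 t1 i1 : i1 < m ->
      xcell h' t1 i1 = xcell h2 t1 i1 + (pr k == t1) * (f == i1).
    move=> i1m; rewrite xcell_upd // [pr k == _]eq_sym [f == _]eq_sym.
    case: eqP => [->|_]; last by rewrite addn0.
    by case: eqP => [->|_] /=; rewrite ?addn0 // muln1 subnK // lt0n.
  have low2 j : j < n -> mem h2 j.+1 = mem h' j.+1.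
    by move=> jn; rewrite /= upd_neq //; move: tb_le; rewrite /tbase /pbase /hbase; lia.
  have r02 : regs h2 0 = k by [].
  have r42 : regs h2 4 = f by [].
  move: h2 st2 xE2 low2 r02 r42 => h2 st2 xE2 low2 r02 r42.
  apply: wp_seqc; apply: (wp_store beta_gt0); rewrite /= r42; first exact: ltn_trans fm m_lt.
  rewrite r02 addn1; set h3 := set_mem h2 _ _.
  have low3 j : j != k -> mem h3 j.+1 = mem h2 j.+1.
    by move=> jk; rewrite /= upd_neq.
  have xE3 t i : xcell h3 t i = xcell h2 t i.
    rewrite /xcell /= upd_neq //; rewrite /xbase /tbase /pbase /hbase; lia.
  have at3 : mem h3 k.+1 = f by rewrite /= upd_eq.
  have st3 : static h3 by exact: static_job.
  have r03 : regs h3 0 = k by [].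
  move: h3 low3 xE3 at3 st3 r03 => h3 low3 xE3 at3 st3 r03.
  have fin : placing x k.+1 (set_reg h3 0 k.+1).
    split=> //.
    + move=> j kj jn; change (mem h3 j.+1 = pr j).
      by rewrite low3 ?gtn_eqF // low2 // jb // ltnW.
    + move=> j; rewrite ltnS => jk; change (mem h3 j.+1 < m).
      have [->|ne] := eqVneq j k; first by rewrite at3.
      by rewrite low3 // low2 ?small //; lia.
    + split=> [t tp|t i tp im].
        change (\sum_(i < m) xcell h3 t i = \sum_(j < n) (k < j) * (pr j == t)).
        apply/eqP; rewrite -(eqn_add2r (pr k == t)); apply/eqP.
        transitivity (\sum_(i < m) xcell h' t i).
          rewrite [RHS](eq_bigr (fun i : 'I_m => xcell h3 t i + (i == f :> nat) * (pr k == t))).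
            by rewrite big_split /= (sum_delta (fun=> nat_of_bool (pr k == t)) fm).
          by move=> i _; rewrite xE3 xE2 // [f == _]eq_sym mulnC.
        rewrite XE // -(sum_delta (fun j => nat_of_bool (pr j == t)) kn) -big_split /=.
        apply: eq_bigr => j _; rewrite -mulnDl; congr (_ * _).
        by rewrite [k <= _]leq_eqVlt eq_sym; case: ltngtP.
      change (xcell h3 t i + \sum_(j < k.+1) (pr j == t) * (mem h3 j.+1 == i) = x t i).
      rewrite -xE // big_ord_recr /= at3 xE3 xE2 //.
      rewrite [X in _ = _ + X](eq_bigr (fun j : 'I_k => (pr j == t) * (mem h3 j.+1 == i))).
        by rewrite addnAC addnA.
      move=> j _; rewrite low3 ?low2 //; last by rewrite ltn_eqF.
      exact: ltn_trans (ltn_ord j) kn.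
  apply: (wp_assign beta_gt0); rewrite /= r03 addn1; last exact: fin.
  exact: leq_ltn_trans kn nB.
- move=> h' _ [{}sth r0 {}jb small [{}XE xE]].
  rewrite /= eval_eN // r0 ltnn; split=> //; split=> // i im.
  rewrite VE // -vload_xcnt; apply: eq_bigr => t _; congr (_ * _).
  have tP : t <= maxp by rewrite -ltnS.
  rewrite -/(x t i) -(xE t i) //; have := leq_sum_term (xcell h' t) im.
  rewrite XE // big1 => [|j _]; last by rewrite leqNgt ltn_ord.
  by rewrite leqn0 => /eqP ->.
- split=> //; first by move=> j _; exact: jb.
  split=> [t tP|t i tP im]; last by rewrite big_ord0 addn0.
  rewrite -[LHS]/(\sum_(i < m) xcell h t i) XE //.
  by apply: eq_bigr => j _; rewrite mul1n.
Qed.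

Lemma cost_ext (u v : nat -> nat) : (forall i, i < m -> u i = v i) -> cost u = cost v.
Proof. by move=> uv; apply: eq_bigr => i _; rewrite uv. Qed.

Lemma table_reach (h : state) (s : nat -> nat) :
  table 0 h -> (forall j, j < n -> s j < m) -> exists e,
    [/\ e < width ^ m, tab h 0 e != 0 & cost (vec 0 e) <= cost (mload n pr s)].
Proof.
move=> [_ _ tp _ [cl _]] sm.
have [s' [s'm gd le]] := good_enough pr m_gt0 num_gt0 den_gt0 sm.
pose x t i := \sum_(j < n) (pr j == t) * (s' j == i).
have vl i : vload n pr x i = mload n pr s' i by exact: vload_xcnt.
have [||||e [eW te eV]] := @walk_reach m n pr num den m_gt0 num_gt0 den_gt0 x _ (tab h).
- by move=> t _; exact: sum_xcnt.
- by move=> i im; rewrite vl; exact: good_near.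
- by rewrite tp // expn_gt0 width_gt0.
- by move=> q j e qn jm eW; exact: cl.
exists e; split=> //; apply: leq_trans le.
by rewrite (cost_ext (v := mload n pr s')) // => i im; rewrite eV // vl.
Qed.

Lemma prog_ok (h : state) : (forall a, mem h a = input a) ->
  wpr prog h (prog_cost n levels ncells (width ^ m) nslots) (fun h' =>
    (forall j, j < n -> mem h' j.+1 < m) /\
    forall s, (forall j, j < n -> s j < m) ->
      cost (mload n pr (fun j => mem h' j.+1)) <= cost (mload n pr s)).
Proof.
move=> memE; apply: wp_seq; apply: wp_conseq (count_ok memE) (leqnn _) _.
move=> {memE}h [p1 s2 me].
apply: wp_seq; apply: wp_conseq (pow_ok p1 s2 me) (leqnn _) _.
move=> {p1 s2 me}h [st jb zero].
apply: wp_seq; apply: wp_conseq (dp_ok st jb zero) (leqnn _) _.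
move=> {st jb zero}h tb.
(* Some state of row 0 is reachable, by comparison with the schedule that puts every job on machine
   0. *)
have ex : exists2 e, e < width ^ m & tab h 0 e != 0.
  by have [e [eW te _]] := table_reach tb (fun _ _ => m_gt0); exists e.
apply: wp_seq; apply: wp_conseq (best_ok tb ex) (leqnn _) _.
move=> {tb ex}h [tb bs].
have opt s : (forall j, j < n -> s j < m) -> cost (vec 0 (regs h 5)) <= cost (mload n pr s).
  move=> sm; have [e [eW te le]] := table_reach tb sm; apply: leq_trans le.
  by have [_ _ ->] := bs.
apply: wp_seq; apply: wp_conseq (back_ok tb bs) (leqnn _) _ => h1 [st jb VE XE].
apply: wp_conseq (assign_ok st jb VE XE) (leqnn _) _ => h2 [sm lE].
by split=> // s sm'; rewrite (cost_ext lE); exact: opt.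
Qed.

End Program.

(** * Instances *)

Import Order.TTheory GRing.Theory Num.Theory.

Lemma wcost_le (N M : nat) (e : expr) (c : stmt) :
  N <= M -> wcost N e c <= wcost 1 e c * M.+1.
Proof. by rewrite /wcost => NM; move: (ecost e) (scost c) => a b; nia. Qed.

Lemma prog_cost_le (m a l c v q M : nat) :
  a <= M -> l <= M -> c <= M -> v <= M -> q <= M ->
  prog_cost m a l c v q <= prog_cost m 1 1 1 1 1 * M.+1.
Proof.
move=> aM lM cM vM qM; rewrite /prog_cost.
move: (wcost_le (Var 0 < eN)%X (count_body m) aM).
move: (wcost_le (Var 0 < eN)%X (assign_body m) aM).
move: (wcost_le (ePw m (Var 3) < eN + Num 1)%X (pow_body m) lM).
move: (wcost_le (Var 0) (dp_body m) cM).
move: (wcost_le (Var 0 < eWm m)%X (best_body m) vM).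
move: (wcost_le (Var 0 < eQ m)%X (back_body m) qM).
move: (wcost _ _ (count_body m)) (wcost _ _ (count_body m)).
move: (wcost _ _ (assign_body m)) (wcost _ _ (assign_body m)).
move: (wcost _ _ (pow_body m)) (wcost _ _ (pow_body m)).
move: (wcost _ _ (dp_body m)) (wcost _ _ (dp_body m)).
move: (wcost _ _ (best_body m)) (wcost _ _ (best_body m)).
move: (wcost _ _ (back_body m)) (wcost _ _ (back_body m)).
move: (scost _) (scost _) (scost _); lia.
Qed.

Section Instance.

Variable m : nat.

Definition input (I : instance m) : nat -> nat := nth 0 (encode I).
Definition job_size (I : instance m) (j : nat) : nat := input I j.+1.
Definition speed_num (I : instance m) (i : nat) : nat := input I (njobs I + (1 + 2 * i)).
Definition speed_den (I : instance m) (i : nat) : nat := input I (njobs I + (2 + 2 * i)).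

Lemma nth_flatten_pairs (T : Type) (f g : T -> nat) (s : seq T) (x0 : T) (k : nat) :
  k < size s ->
  let p := flatten [seq [:: f x; g x] | x <- s] in
  nth 0 p (2 * k) = f (nth x0 s k) /\ nth 0 p (2 * k).+1 = g (nth x0 s k).
Proof.
elim: s k => // x s ih [|k] // ks.
rewrite mulnS; exact: (ih k ks).
Qed.

Lemma size_flatten_pairs (T : Type) (f g : T -> nat) (s : seq T) :
  size (flatten [seq [:: f x; g x] | x <- s]) = 2 * size s.
Proof. by elim: s => //= x s ->; rewrite mulnS. Qed.

Lemma job_sizeE (I : instance m) (j : 'I_(njobs I)) : job_size I j = preq j.
Proof.
rewrite /job_size /input /encode /= nth_cat size_map size_enum_ord ltn_ord.
by rewrite (nth_map j) ?size_enum_ord // nth_ord_enum.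
Qed.

Lemma nth_speeds (I : instance m) (k : nat) :
  input I (njobs I + k.+1) =
  nth 0 (flatten [seq [:: absz (numq (speed I i)); absz (denq (speed I i))] | i <- enum 'I_m]) k.
Proof.
rewrite /input /encode addnS /= nth_cat size_map size_enum_ord.
by rewrite ltnNge leq_addr /= addKn.
Qed.

Lemma speed_numE (I : instance m) (i : 'I_m) : speed_num I i = absz (numq (speed I i)).
Proof.
rewrite /speed_num add1n nth_speeds.
have [|-> _] := @nth_flatten_pairs _ (fun i => absz (numq (speed I i)))
  (fun i => absz (denq (speed I i))) (enum 'I_m) i i; first by rewrite size_enum_ord.
by rewrite nth_ord_enum.
Qed.

Lemma speed_denE (I : instance m) (i : 'I_m) : speed_den I i = absz (denq (speed I i)).
Proof.
rewrite /speed_den add2n nth_speeds.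
have [|_ ->] := @nth_flatten_pairs _ (fun i => absz (numq (speed I i)))
  (fun i => absz (denq (speed I i))) (enum 'I_m) i i; first by rewrite size_enum_ord.
by rewrite nth_ord_enum.
Qed.

Lemma input_end (I : instance m) (a : nat) : njobs I + (1 + 2 * m) <= a -> input I a = 0.
Proof.
move=> le; rewrite /input nth_default //; apply: leq_trans le.
rewrite /encode /= size_cat size_map size_enum_ord size_flatten_pairs size_enum_ord.
by rewrite add1n addnS.
Qed.

Lemma speed_num_gt0 (I : instance m) (i : nat) : i < m -> 0 < speed_num I i.
Proof.
move=> im; rewrite (speed_numE I (Ordinal im)) absz_gt0 numq_eq0.
by rewrite gt_eqF // speed_gt0.
Qed.

Lemma speed_den_gt0 (I : instance m) (i : nat) : i < m -> 0 < speed_den I i.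
Proof. by move=> im; rewrite (speed_denE I (Ordinal im)) absz_gt0 denq_neq0. Qed.

Lemma speedE (I : instance m) (i : 'I_m) :
  speed I i = ((speed_num I i)%:R / (speed_den I i)%:R)%R.
Proof.
have num0 : (0 <= numq (speed I i))%R by rewrite numq_ge0 ltW // speed_gt0.
by rewrite speed_numE speed_denE !natr_absz !ger0_norm ?denq_ge0 // divq_num_den.
Qed.

Lemma maxpE (I : instance m) : maxp (njobs I) (job_size I) = pmax I.
Proof. by apply: eq_bigr => j _; rewrite job_sizeE. Qed.

Lemma loadE (I : instance m) (s : schedule I) (u : nat -> nat) (i : 'I_m) :
  (forall j : 'I_(njobs I), u j = s j) ->
  load s i = ((mload (njobs I) (job_size I) u i)%:R / speed I i)%R.
Proof.
move=> us; rewrite /load -mulr_suml; congr (_ * _)%R.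
rewrite /mload natr_sum big_mkcond /=; apply: eq_bigr => j _.
by rewrite us job_sizeE -val_eqE; case: eqP; rewrite ?mul1n ?mul0n.
Qed.

(** The product of all numerators clears the denominators of all loads at once. The factor does not
    depend on the machine, so [cost] ranks schedules as [makespan] does. *)
Lemma load_wgt (I : instance m) (s : schedule I) (u : nat -> nat) (i : 'I_m) :
  (forall j : 'I_(njobs I), u j = s j) ->
  ((mload (njobs I) (job_size I) u i * wgt m (speed_num I) (speed_den I) i)%:R =
  load s i * (\prod_(k < m) speed_num I k)%:R :> rat)%R.
Proof.
move=> us; rewrite (loadE i us) speedE invf_div natrM -!mulrA; congr (_ * _)%R.
have n0 : ((speed_num I i)%:R != 0 :> rat)%R.
  by rewrite pnatr_eq0 -lt0n speed_num_gt0.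
rewrite /wgt (bigD1 i) //= eqxx [in RHS](bigD1 i) //= !natrM mulKf //.
congr (_ * _%:R)%R; apply: eq_bigr => k; rewrite -val_eqE /=.
by case: eqP.
Qed.

Hypothesis m_gt0 : 0 < m.

Lemma optimal_of_cost (I : instance m) (s : schedule I) (u : nat -> nat) :
  (forall j : 'I_(njobs I), u j = s j) ->
  (forall v, (forall j, j < njobs I -> v j < m) ->
     cost m (speed_num I) (speed_den I) (mload (njobs I) (job_size I) u) <=
     cost m (speed_num I) (speed_den I) (mload (njobs I) (job_size I) v)) ->
  optimal s.
Proof.
move=> us opt s'.
pose v j := if insub j is Some j' then nat_of_ord (s' j') else 0.
have vs (j : 'I_(njobs I)) : v j = s' j by rewrite /v valK.
have vm j : j < njobs I -> v j < m by move=> jn; rewrite (vs (Ordinal jn)).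
have le := opt v vm.
have ms0 : (0 <= makespan s')%R by apply: bigmax_ge_id.
apply: bigmax_le => // i _.
have P0 : (0 < (\prod_(k < m) speed_num I k)%:R :> rat)%R.
  by rewrite ltr0n prodn_gt0 // => k; exact: speed_num_gt0.
rewrite -(ler_pM2r P0) -(load_wgt i us).
have [|i' costE] := bigop.eq_bigmax (fun i : 'I_m =>
  mload (njobs I) (job_size I) v i * wgt m (speed_num I) (speed_den I) i).
  by rewrite card_ord.
apply: (@le_trans _ _ (load s' i' * (\prod_(k < m) speed_num I k)%:R)%R).
  rewrite -(load_wgt i' vs) ler_nat -costE; apply: leq_trans le.
  exact: leq_cost.
rewrite ler_pM2r //; exact: (le_bigmax _ (load s') i').
Qed.

(** * Quantities that fit into a constant number of input words *)

Definition poly_bits (f : instance m -> nat) : Prop :=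
  exists k, forall I, f I < 2 ^ (k * input_bits I).

Lemma poly_bits_le (f g : instance m -> nat) :
  (forall I, f I <= g I) -> poly_bits g -> poly_bits f.
Proof. by move=> fg [k gk]; exists k => I; apply: leq_ltn_trans (gk I). Qed.

Lemma poly_bits_mul (f g : instance m -> nat) :
  poly_bits f -> poly_bits g -> poly_bits (fun I => f I * g I).
Proof.
move=> [k fk] [l gl]; exists (k + l) => I.
by rewrite mulnDl expnD ltn_mul.
Qed.

Lemma poly_bits_add (f g : instance m -> nat) :
  poly_bits f -> poly_bits g -> poly_bits (fun I => f I + g I).
Proof.
move=> [k fk] [l gl]; exists (k + l).+1 => I.
exact: (@eval_binop_lt (input_bits I) _ Add).
Qed.

Lemma poly_bits_const (c : nat) : poly_bits (fun=> c).
Proof.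
exists c => I; apply: leq_trans (ltn_expl c (isT : 1 < 2)) _.
by rewrite leq_exp2l // leq_pmulr.
Qed.

Lemma poly_bits_exp (f : instance m -> nat) (k : nat) :
  poly_bits f -> poly_bits (fun I => f I ^ k).
Proof.
move=> pf; elim: k => [|k ih]; first exact: (poly_bits_const 1).
by apply: poly_bits_le (poly_bits_mul pf ih) => I; rewrite expnS.
Qed.

Lemma poly_bits_sum (k : nat) (f : nat -> instance m -> nat) :
  (forall i, i < k -> poly_bits (f i)) -> poly_bits (fun I => \sum_(i < k) f i I).
Proof.
elim: k => [|k ih] pf.
  by apply: poly_bits_le (poly_bits_const 0) => I; rewrite big_ord0.
have := poly_bits_add (ih (fun i ik => pf i (ltnW ik))) (pf k (ltnSn k)).
by apply: poly_bits_le => I; rewrite big_ord_recr.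
Qed.

Lemma poly_bits_prod (k : nat) (f : nat -> instance m -> nat) :
  (forall i, i < k -> poly_bits (f i)) -> poly_bits (fun I => \prod_(i < k) f i I).
Proof.
elim: k => [|k ih] pf.
  by apply: poly_bits_le (poly_bits_const 1) => I; rewrite big_ord0.
have := poly_bits_mul (ih (fun i ik => pf i (ltnW ik))) (pf k (ltnSn k)).
by apply: poly_bits_le => I; rewrite big_ord_recr.
Qed.

Lemma input_lt (I : instance m) (a : nat) : input I a < 2 ^ input_bits I.
Proof.
have [le|lt] := leqP (size (encode I)) a.
  by rewrite /input nth_default // expn_gt0.
apply: leq_ltn_trans (trunc_log_ltn _ (isT : 1 < 2)).
exact: (@bigop.leq_bigmax_seq nat (encode I) xpredT id _ (mem_nth 0 lt)).
Qed.

Lemma poly_bits_input (a : instance m -> nat) : poly_bits (fun I => input I (a I)).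
Proof. by exists 1 => I; rewrite mul1n input_lt. Qed.

Lemma poly_bits_njobs : poly_bits (@njobs m).
Proof. exact: (poly_bits_input (fun=> 0)). Qed.

Lemma poly_bits_pmax : poly_bits (fun I => maxp (njobs I) (job_size I)).
Proof.
exists 1 => I; rewrite mul1n; have P0 : 0 < 2 ^ input_bits I by rewrite expn_gt0.
suff : maxp (njobs I) (job_size I) <= (2 ^ input_bits I).-1 by lia.
by apply/bigmax_leqP => j _; have := input_lt I j.+1; rewrite /job_size; lia.
Qed.

Lemma poly_bits_wgt (i : nat) :
  i < m -> poly_bits (fun I => wgt m (speed_num I) (speed_den I) i).
Proof.
move=> im; apply: (poly_bits_prod (f := fun k I =>
  if k == i then speed_den I k else speed_num I k)) => k _.
by case: eqP => _; apply: poly_bits_input.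
Qed.

Let Wid (I : instance m) := width m (njobs I) (job_size I).
Let Tot (I : instance m) := total (njobs I) (job_size I).
Let Slots (I : instance m) := nslots m (njobs I) (job_size I).

Lemma poly_bits_total : poly_bits Tot.
Proof.
apply: poly_bits_le (poly_bits_mul poly_bits_njobs poly_bits_pmax) => I.
exact: total_le.
Qed.

Lemma pow_levels_le (n : nat) : 0 < n -> 2 ^ levels n <= 2 * n.
Proof. by move=> n0; rewrite expnS leq_mul2l trunc_logP. Qed.

Lemma poly_bits_levels : poly_bits (fun I => 2 ^ levels (njobs I)).
Proof.
apply: poly_bits_le (poly_bits_mul (poly_bits_const 2) poly_bits_njobs) => I.
exact: pow_levels_le (njobs_gt0 I).
Qed.

Lemma poly_bits_width : poly_bits Wid.
Proof.
have pS := poly_bits_add poly_bits_pmax (poly_bits_const 1).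
have := poly_bits_mul (poly_bits_const 2)
  (poly_bits_mul (poly_bits_const (4 * m)) (poly_bits_mul pS pS)).
by apply: poly_bits_le => I; rewrite addn1.
Qed.

Lemma poly_bits_nslots : poly_bits Slots.
Proof.
have pS := poly_bits_add poly_bits_pmax (poly_bits_const 1).
have := poly_bits_mul poly_bits_levels (poly_bits_mul pS (poly_bits_const m)).
apply: poly_bits_le => I; rewrite addn1 leq_mul2r.
by rewrite (ltnW (ltn_expl _ _)) ?orbT.
Qed.

(** The sum of all the bounds required by the correctness proof, so that a single exponent serves
    them all. *)
Definition word_bound (I : instance m) : nat :=
  (njobs I).+1 + Tot I + 2 ^ levels (njobs I)
  + (Slots I * Wid I ^ m * m + Wid I ^ m * m + 1)
  + \sum_(i < m) ((Wid I + Tot I) * wgt m (speed_num I) (speed_den I) i + 1).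

Lemma poly_bits_word_bound : poly_bits word_bound.
Proof.
have p1 := poly_bits_const 1; have pm := poly_bits_const m.
have pW := poly_bits_exp m poly_bits_width.
apply: poly_bits_add; last first.
  apply: (poly_bits_sum (f := fun i I =>
    (Wid I + Tot I) * wgt m (speed_num I) (speed_den I) i + 1)) => i im.
  apply: poly_bits_add p1.
  exact: poly_bits_mul (poly_bits_add poly_bits_width poly_bits_total) (poly_bits_wgt im).
apply: poly_bits_add; last first.
  apply: poly_bits_add p1; apply: poly_bits_add (poly_bits_mul pW pm).
  exact: poly_bits_mul (poly_bits_mul poly_bits_nslots pW) pm.
apply: poly_bits_add poly_bits_levels; apply: poly_bits_add poly_bits_total.
by apply: poly_bits_le (poly_bits_add poly_bits_njobs p1) => I; rewrite addn1.
Qed.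

(** * Word length and running time of the program *)

Definition run_time (I : instance m) : nat :=
  prog_cost m (njobs I) (levels (njobs I)) (ncells m (njobs I) (job_size I))
            (Wid I ^ m) (Slots I).

Lemma prog_solves : solves_in_time (compile (prog m)) run_time.
Proof.
have [K boundK] := poly_bits_word_bound.
(* The program depends on [m] alone, so its width is a constant. [K.+1] rather than [K] ensures that
   the input cells fit as well, even if [K] is 0. *)
exists (swidth K.+1 (prog m)) => I.
set beta := input_bits I; have beta_gt0 : 0 < beta by [].
have lt_word a : a <= word_bound I -> a < 2 ^ (K.+1 * beta).
  move=> le; apply: leq_ltn_trans le (leq_trans (boundK I) _).
  by rewrite leq_exp2l // leq_mul2r leqnSn orbT.
have wgt_le i : i < m ->
    (Wid I + Tot I) * wgt m (speed_num I) (speed_den I) i + 1 <= word_bound I.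
  move=> im; apply: leq_trans (leq_addl _ _).
  exact: (leq_sum_term (fun i =>
    (Wid I + Tot I) * wgt m (speed_num I) (speed_den I) i + 1) im).
have fit : fits K.+1 beta (init_state I).
  split=> [x|a] /=; first by rewrite expn_gt0.
  apply: leq_trans (input_lt I a) _.
  by rewrite leq_exp2l // mulSn leq_addr.
have ag : agree (init_state I) (init_state I) by [].
have := @prog_ok m (njobs I) (job_size I) (speed_num I) (speed_den I) m_gt0
  (njobs_gt0 I) (@speed_num_gt0 I) (@speed_den_gt0 I) (input I) erefl
  (fun _ _ => erefl) (fun _ _ => erefl) (fun _ _ => erefl) (@input_end I)
  K.+1 beta (swidth K.+1 (prog m) * beta) beta_gt0.
case/(_ _ _ _ _ _ (init_state I) (fun=> erefl) (leqnn _) fit _ ag).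
- by apply: lt_word; rewrite /word_bound; lia.
- by apply: lt_word; rewrite /word_bound /Tot; lia.
- by apply: lt_word; rewrite /word_bound; lia.
- by apply: lt_word; rewrite /word_bound /Slots /Wid; lia.
- by move=> i im; apply: lt_word; exact: wgt_le.
move=> t [st [h' [ex tT [memE _] _ [small opt]]]].
exists t, st, (fun j : 'I_(njobs I) => Ordinal (small j (ltn_ord j))); split=> //.
  by move=> j; rewrite memE.
exact: (optimal_of_cost (u := fun j => mem h' j.+1)).
Qed.

Lemma run_time_softO : softO run_time (fun I => pmax I ^ (2 * m + 2) + njobs I).
Proof.
(* The number of transitions is [levels] times [m * m * (8 * m) ^ m * p.+1 ^ (2 * m + 1)]; the last
   factor of [c2] pays for replacing [p.+1] by [p]. The single logarithm comes from [levels]. *)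
pose c1 := prog_cost m 1 1 1 1 1; pose c2 := m * m * (8 * m) ^ m * 2 ^ (2 * m + 1).
exists (c1 * (2 + c2)), 1 => I; rewrite expn1.
set p := pmax I; set n := njobs I; set f := p ^ (2 * m + 2) + n.
have n0 : 0 < n by exact: njobs_gt0.
have nf : n <= f by exact: leq_addl.
set L := (trunc_log 2 f).+1.
have lev : levels n <= L by rewrite ltnS leq_trunc_log.
have W0 : 0 < Wid I ^ m by rewrite expn_gt0 width_gt0.
have S0 : 0 < Slots I by rewrite muln_gt0 lsize_gt0.
pose N := ncells m n (job_size I).
have NE : N = Slots I * Wid I ^ m * m by [].
have vN : Wid I ^ m <= N by rewrite NE -mulnA mulnC -mulnA leq_pmulr // muln_gt0 m_gt0.
have qN : Slots I <= N by rewrite NE -mulnA leq_pmulr // muln_gt0 W0.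
have lN : levels n <= N by apply: leq_trans qN; rewrite leq_pmulr // lsize_gt0.
have p_le : p.+1 ^ (2 * m + 1) <= 2 ^ (2 * m + 1) * f.
  (* For [p = 0] the power of [p] in [f] vanishes and the term [n >= 1] takes over; otherwise
     [p.+1 <= 2 * p]. *)
  have [p0|p0] := posnP p.
    rewrite p0 exp1n muln_gt0 expn_gt0 /=; exact: leq_trans n0 nf.
  apply: (@leq_trans ((2 * p) ^ (2 * m + 1))); first by rewrite leq_exp2r //; lia.
  rewrite expnMn leq_mul2l; apply/orP; right; apply: leq_trans (leq_addr _ _).
  by rewrite leq_pexp2l //; lia.
have N_le : N <= c2 * f * L.
  have widE : Wid I = 8 * m * (p.+1 * p.+1).
    by rewrite /Wid /width /radius maxpE -/p; lia.
  have -> : N = levels n * (m * m * (8 * m) ^ m * p.+1 ^ (2 * m + 1)).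
    rewrite NE widE /Slots /nslots /lsize maxpE -/p -/n (expnMn (8 * m)).
    by rewrite mulnn -expnM addn1 expnS; lia.
  rewrite mulnC leq_mul //; apply: leq_trans (leq_mul (leqnn _) p_le) _.
  by rewrite /c2 !mulnA.
apply: leq_trans (prog_cost_le m (leq_addr N n) (leq_trans lN (leq_addl n N))
  (leq_addl n N) (leq_trans vN (leq_addl n N)) (leq_trans qN (leq_addl n N))) _.
rewrite -/c1 -!mulnA leq_mul2l; apply/orP; right.
have fL : f <= f * L by rewrite leq_pmulr.
by rewrite mulnDl mulnA; lia.
Qed.

End Instance.

Theorem theorem1 (m : nat) (m_gt0 : 0 < m) :
  exists (c : cmd) (T : instance m -> nat),
    solves_in_time c T /\
    softO T (fun I : instance m => pmax I ^ (2 * m + 2) + njobs I).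
Proof.
exists (compile (prog m)), (@run_time m); split.
  exact: prog_solves m_gt0.
exact: run_time_softO m_gt0.
Qed.
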